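(* Let $(\varrho(t),\theta(t))$, with $\varrho=\rho\mu$, be a solution of the geodesic equations in Hamiltonian form $$\dot\rho=-\operatorname{div}(\rho\nabla\theta)+\xi\rho,\qquad \dot\theta=-\frac12|\nabla\theta|^2-\xi\theta+\frac{\xi^2}{2},$$ where $m=\int_M\varrho$ is the total volume and $\xi=\frac1m\int_M\theta\varrho$. Let $$H(\varrho,\theta)=\frac12\int_M|\nabla\theta|^2\varrho+\frac{1}{2m}\left(\int_M\theta\varrho\right)^2.$$ Then $m$ and $\xi$ satisfy the equations $$\dot\xi=\frac1m\left(H(\varrho,\theta)-m\xi^2\right),\qquad \dot m=m\xi,$$ which can also be written as the second order equation $$\ddot m=H.$$
   Context: $M$ is an $n$-dimensional Riemannian manifold with volume form $\mu$ of total volume $\int_M\mu=1$ (for most applications one can think of a compact $M$, but the case $M=\mathbb{R}^n$ with Gaussian densities is also kept in mind). $\varrho=\rho\mu$ is a smooth volume form (positive density, $\rho>0$) on $M$ of finite, arbitrary total volume, and $\theta$ is a smooth real function on $M$, both depending on time $t$. $\operatorname{div}$ is the divergence with respect to $\mu$; $\nabla$ and $|\cdot|$ refer to the Riemannian metric of $M$. Dots denote time derivatives. The displayed geodesic equations are Hamilton's equations for $H$ with respect to the pairing $\langle\dot\varrho,\theta\rangle=\int_M\theta\dot\varrho$.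
   Formalization: For noncompact M the formal theorem also assumes that ∫θϱ and ∫|∇θ|²ϱ converge, that the time derivatives of ρ and θρ are locally dominated by an integrable function, and that no flux of ρ∇θ or θρ∇θ escapes at infinity; without this the claim fails, e.g. on M=(0,1). *)

(* Defs.v *)
From HB Require Import structures.
From mathcomp Require Import all_boot all_order all_algebra.
From mathcomp Require Import all_classical all_reals all_analysis.

Set Implicit Arguments.
Unset Strict Implicit.
Unset Printing Implicit Defensive.

Import Order.TTheory GRing.Theory Num.Theory.
Import numFieldNormedType.Exports.

Local Open Scope classical_set_scope.
Local Open Scope ring_scope.

Section Euclidean.
Context {R : realType}.

Definition basis_vec {n} (k : 'I_n) : 'rV[R]_n := delta_mx 0 k.

Definition partial {n} (k : 'I_n) (f : 'rV[R]_n -> R) : 'rV[R]_n -> R :=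
  'D_(basis_vec k) f.

(* C^infinity on A, meant for A open: all iterated partial derivatives exist
   and are continuous at every point of A. *)
Definition smooth_on {n} (A : set 'rV[R]_n) (f : 'rV[R]_n -> R) : Prop :=
  forall (s : seq 'I_n) (x : 'rV[R]_n), A x ->
    {for x, continuous (foldr partial f s)} /\
    forall k : 'I_n, derivable (foldr partial f s) x (basis_vec k).

(* Integration against Lebesgue measure on R^n as an iterated integral; by
   Tonelli this is the n-dimensional Lebesgue integral of a nonnegative Borel
   function, and it is only applied to such functions. *)
Fixpoint lebesgue_integral_rV (n : nat) : ('rV[R]_n -> \bar R) -> \bar R :=
  match n with
  | 0 => fun f => f 0
  | n'.+1 => fun f =>
      (\int[lebesgue_measure]_x
        lebesgue_integral_rV (fun y : 'rV[R]_n' =>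
          f (row_mx (x%:M : 'rV[R]_1) y : 'rV[R]_(1 + n'))))%E
  end.

End Euclidean.

Record chart (R : realType) (n : nat) (M : topologicalType) := Chart {
  cdom : set M;
  cmap : M -> 'rV[R]_n;
  cinv : 'rV[R]_n -> M;
  cdom_open : open cdom;
  cimg_open : open (cmap @` cdom);
  cmapK : forall p, cdom p -> cinv (cmap p) = p;
  cmap_continuous : forall p, cdom p -> {for p, continuous cmap};
  cinv_continuous : forall x, (cmap @` cdom) x -> {for x, continuous cinv}
}.

Definition cimg R n M (c : chart R n M) : set 'rV[R]_n := cmap c @` cdom c.

Definition transition R n M (c c' : chart R n M) (x : 'rV[R]_n) : 'rV[R]_n :=
  cmap c' (cinv c x).

(* A smooth manifold without boundary, given by an atlas, with a Riemannian
   metric given by its Gram matrices in the charts.  The Jacobian matrix 'J is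
   the one acting on row vectors on the right: ('J f x) k l is the k-th partial
   derivative of the l-th component of f. *)
Record riemannian_manifold (R : realType) (n : nat) := RiemannianManifold {
  carrier :> ptopologicalType;
  carrier_hausdorff : hausdorff_space carrier;
  carrier_second_countable : @second_countable carrier;
  chart_index : Type;
  atlas : chart_index -> chart R n carrier;
  atlas_cover : forall p : carrier, exists i, cdom (atlas i) p;
  atlas_smooth : forall i j (k : 'I_n),
    smooth_on (cmap (atlas i) @` (cdom (atlas i) `&` cdom (atlas j)))
              (fun x => transition (atlas i) (atlas j) x 0 k);
  gram : chart_index -> 'rV[R]_n -> 'M[R]_n;
  gram_smooth : forall i (k l : 'I_n),
    smooth_on (cimg (atlas i)) (fun x => gram i x k l);
  gram_sym : forall i x, cimg (atlas i) x -> (gram i x)^T = gram i x;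
  gram_pos : forall i x (v : 'rV[R]_n), cimg (atlas i) x -> v != 0 ->
    0 < (v *m gram i x *m v^T) 0 0;
  gram_compat : forall i j p, cdom (atlas i) p -> cdom (atlas j) p ->
    let J := 'J (transition (atlas i) (atlas j)) (cmap (atlas i) p) in
    gram i (cmap (atlas i) p) = J *m gram j (cmap (atlas j) p) *m J^T
}.

(* A volume form, i.e. a nowhere vanishing top-degree form, equal to
   vdens i x * dx_1 /\ ... /\ dx_n in the chart i. *)
Record volume_form (R : realType) (n : nat) (M : riemannian_manifold R n) :=
  VolumeForm {
  vdens :> chart_index M -> 'rV[R]_n -> R;
  vdens_smooth : forall i, smooth_on (cimg (atlas i)) (vdens i);
  vdens_neq0 : forall i x, cimg (atlas i) x -> vdens i x != 0;
  vdens_compat : forall i j p, cdom (atlas i) p -> cdom (atlas j) p ->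
    vdens i (cmap (atlas i) p) =
      \det ('J (transition (atlas i) (atlas j)) (cmap (atlas i) p))
      * vdens j (cmap (atlas j) p)
}.

Definition borel (T : ptopologicalType) := g_sigma_algebraType (@open T).

(* mu is the Borel measure of integration against the volume form w, for the
   orientation of M in which w is positive (hence the absolute value). *)
Definition volume_measure (R : realType) (n : nat) (M : riemannian_manifold R n)
    (w : volume_form M) (mu : {measure set (borel M) -> \bar R}) : Prop :=
  forall i (A : set (borel M)), measurable A -> A `<=` cdom (atlas i) ->
    mu A = lebesgue_integral_rV (fun x =>
             (\1_(cmap (atlas i) @` A) x * `|w i x|)%:E).

Section Calculus.
Context {R : realType} {n : nat} {M : riemannian_manifold R n}.

Definition smooth_fun (f : M -> R) : Prop :=
  forall i, smooth_on (cimg (atlas i)) (f \o cinv (atlas i)).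

(* Joint smoothness in (t, p), read in R x chart, the first coordinate of
   'rV_(1 + n) being the time. *)
Definition smooth_time_fun (I : set R) (f : R -> M -> R) : Prop :=
  forall i, smooth_on
    [set z : 'rV[R]_(1 + n) | I (lsubmx z 0 0) /\ cimg (atlas i) (rsubmx z)]
    (fun z => f (lsubmx z 0 0) (cinv (atlas i) (rsubmx z))).

(* A vector field is represented by its components in every chart: X i p is
   meaningful for p in the domain of the chart i. *)
Definition vector_field := chart_index M -> M -> 'rV[R]_n.

Definition scale_field (f : M -> R) (X : vector_field) : vector_field :=
  fun i p => f p *: X i p.

Definition grad (f : M -> R) : vector_field := fun i p =>
  (\row_k partial k (f \o cinv (atlas i)) (cmap (atlas i) p))
  *m invmx (gram i (cmap (atlas i) p)).

Definition chart_at (p : M) : chart_index M := projT1 (cid (atlas_cover p)).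

(* The pairing of tangent vectors does not depend on the chart, so any chart
   around p can be used to evaluate it. *)
Definition metric (X Y : vector_field) (p : M) : R :=
  let i := chart_at p in
  (X i p *m gram i (cmap (atlas i) p) *m (Y i p)^T) 0 0.

Definition sqnorm (X : vector_field) (p : M) : R := metric X X p.

(* Divergence with respect to w, computed in the chart i: the defining identity
   d(i_X w) = div(X) w reads div(X) = (1 / w) sum_k d_k (w X^k). *)
Definition div (w : volume_form M) (X : vector_field)
    (i : chart_index M) (p : M) : R :=
  (w i (cmap (atlas i) p))^-1 *
  \sum_(k < n) partial k (fun x => w i x * X i (cinv (atlas i) x) 0 k)
                         (cmap (atlas i) p).

Section Transport.
Variables (w : volume_form M) (mu : {measure set (borel M) -> \bar R}).

Definition mass (rho : M -> R) : R :=
  (\int[mu]_p (rho p))%R.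

Definition mean_value (rho theta : M -> R) : R :=
  (mass rho)^-1 * (\int[mu]_p (theta p * rho p))%R.

Definition hamiltonian (rho theta : M -> R) : R :=
  2^-1 * (\int[mu]_p (sqnorm (grad theta) p * rho p))%R
  + (2 * mass rho)^-1 * (\int[mu]_p (theta p * rho p))%R ^+ 2.

(* A smooth solution on the time set I (an open set, e.g. an open interval).
   The continuity equation is required in every chart. *)
Record geodesic_solution (I : set R) (rho theta : R -> M -> R) : Prop :=
  GeodesicSolution {
  sol_rho_smooth : smooth_time_fun I rho;
  sol_theta_smooth : smooth_time_fun I theta;
  sol_rho_pos : forall t p, I t -> 0 < rho t p;
  sol_finite_volume : forall t, I t ->
    mu.-integrable [set: borel M] (EFin \o rho t);
  sol_rho_eq : forall t i p, I t -> cdom (atlas i) p ->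
    derive1 (rho ^~ p) t =
      - div w (scale_field (rho t) (grad (theta t))) i p
      + mean_value (rho t) (theta t) * rho t p;
  sol_theta_eq : forall t p, I t ->
    derive1 (theta ^~ p) t =
      - (2^-1 * sqnorm (grad (theta t)) p)
      - mean_value (rho t) (theta t) * theta t p
      + mean_value (rho t) (theta t) ^+ 2 / 2
}.

(* Decay conditions that make the integrals meaningful on a noncompact manifold:
   the energy is finite, the two time-dependent integrals can be differentiated
   under the integral sign, and, along some sequence of cutoff functions, no flux
   of rho grad(theta) or theta rho grad(theta) escapes at infinity. *)
Record decay_at_infinity (I : set R) (rho theta : R -> M -> R) : Prop :=
  DecayAtInfinity {
  decay_momentum : forall t, I t ->
    mu.-integrable [set: borel M] (fun p => (theta t p * rho t p)%:E);
  decay_energy : forall t, I t ->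
    mu.-integrable [set: borel M]
      (fun p => (sqnorm (grad (theta t)) p * rho t p)%:E);
  decay_dominated : forall t0, I t0 -> exists2 G : M -> R,
    mu.-integrable [set: borel M] (EFin \o G) &
    \forall t \near t0, forall p,
      `|derive1 (rho ^~ p) t| <= G p /\
      `|derive1 (fun s => theta s p * rho s p) t| <= G p;
  decay_flux : forall t, I t -> exists chi : nat -> M -> R,
    [/\ forall k, smooth_fun (chi k),
        forall k, exists2 K : set M, compact K &
          forall p, ~ K p -> chi k p = 0,
        forall k p, 0 <= chi k p <= 1,
        forall p, chi k p @[k --> \oo] --> (1 : R) &
        (\int[mu]_p (metric (grad (chi k)) (grad (theta t)) p * rho t p))%R
          @[k --> \oo] --> (0 : R) /\
        (\int[mu]_p (metric (grad (chi k)) (grad (theta t)) p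
                     * theta t p * rho t p))%R
          @[k --> \oo] --> (0 : R)]
}.

End Transport.
End Calculus.

(* Main.v *)
(* The mass m and the momentum P = int theta rho = m xi satisfy m' = P and P' = H;
   the three equations follow by elementary calculus.  Both derivatives are taken
   under the integral sign and evaluated with Green's formula
     int f div(rho grad theta) + int <grad f, grad theta> rho = 0
   for f = 1 and f = theta.  Green's formula for compactly supported f is reduced to
   the charts by bump functions; in a chart it says that the partial derivatives of
   a compactly supported C^1 function on R^n have integral 0, which follows from the
   translation invariance of Lebesgue measure.  The general case is the limit along
   the cutoff functions (the constant 1 if M is compact). *)
Require Import Defs.
From HB Require Import structures.
From mathcomp Require Import all_boot all_order all_algebra.
From mathcomp Require Import finmap.
From mathcomp Require Import all_classical all_reals all_analysis.
From mathcomp Require Import measurable_realfun ring lra.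
Import Order.TTheory GRing.Theory Num.Theory.
Import numFieldNormedType.Exports.
Local Open Scope classical_set_scope.
Local Open Scope ring_scope.

Set Implicit Arguments.
Unset Strict Implicit.
Unset Printing Implicit Defensive.

(** The hypothesis [volume_measure] describes [mu] only on Borel subsets of a single chart, through
    an iterated integral of an indicator. The iterated integral is therefore realised by a genuine
    Borel measure on $\mathbb{R}^n$, to which the convergence theorems apply. The operator [div] is
    also given chart by chart. Its invariance is never computed: the continuity equation itself
    exhibits the divergence as the global function $\xi\rho-\dot\rho$. Green's formula
    differentiates its test function only once, so $C^1$ bumps are enough and can be piecewise
    polynomial. In $\dot\theta\rho+\theta\dot\rho$ the terms $\pm\xi\theta\rho$ cancel. Green's
    formula for $f=\theta$ contributes $\int|\nabla\theta|^2\varrho$, of which half is taken away by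
    $\dot\theta$. The rest, $\frac{\xi^2}{2}m$, is the second term of $H$ because $P=m\xi$. *)

(** * Functions of class $C^1$ on open subsets of $\mathbb{R}^n$ *)

Section C1.
Context {R : realType} {n : nat}.
Implicit Types (A : set 'rV[R]_n) (f g : 'rV[R]_n -> R) (x : 'rV[R]_n).

Definition C1_on A f := forall x, A x ->
  {for x, continuous f} /\
  forall k, derivable f x (basis_vec k) /\ {for x, continuous (partial k f)}.

(** Introduction rule with a candidate gradient [df]: since [A] is open, [partial k f] agrees with
    [df k] on a neighbourhood of each point, so continuity passes from one to the other. *)
Lemma C1_on_is_derive A f (df : 'I_n -> 'rV[R]_n -> R) : open A ->
  (forall x, A x -> {for x, continuous f}) ->
  (forall x k, A x -> is_derive x (basis_vec k) f (df k x)) ->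
  (forall x k, A x -> {for x, continuous (df k)}) -> C1_on A f.
Proof.
move=> oA cf ff' cf' x Ax; split; [exact: cf|move=> k; split].
  by have [] := ff' x k Ax.
have e : partial k f x = df k x by have [_ <-] := ff' x k Ax.
rewrite /prop_for /continuous_at e; apply: cvg_trans (cf' x k Ax).
apply: (@near_eq_cvg _ _ (nbhs x)); apply: filterS (open_nbhs_nbhs (conj oA Ax)) => y Ay.
by have [_ <-] := ff' y k Ay.
Qed.

Lemma C1_on_derivable A f x k : C1_on A f -> A x -> derivable f x (basis_vec k).
Proof. by move=> /[apply] -[_ /(_ k)[]]. Qed.

Lemma C1_on_is_deriveP A f x k : C1_on A f -> A x ->
  is_derive x (basis_vec k) f (partial k f x).
Proof. by move=> fA Ax; apply: derivableP; exact: C1_on_derivable fA Ax. Qed.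

Lemma C1_on_continuous A f x : C1_on A f -> A x -> {for x, continuous f}.
Proof. by move=> /[apply] -[]. Qed.

Lemma C1_on_partial_continuous A f x k : C1_on A f -> A x ->
  {for x, continuous (partial k f)}.
Proof. by move=> /[apply] -[_ /(_ k)[]]. Qed.

Lemma sub_C1_on A B f : A `<=` B -> C1_on B f -> C1_on A f.
Proof. by move=> AB fB x /AB; exact: fB. Qed.

Lemma eq_C1_on A f g : open A -> (forall x, A x -> f x = g x) ->
  C1_on A f -> C1_on A g.
Proof.
move=> oA fg fA.
have nfg x : A x -> \near x, f x = g x.
  by move=> Ax; apply: filterS (open_nbhs_nbhs (conj oA Ax)) => y /fg.
apply: (@C1_on_is_derive _ _ (fun k => partial k f)) => // [x Ax|x k Ax|x k Ax].
- rewrite /prop_for /continuous_at -fg//; apply: cvg_trans (C1_on_continuous fA Ax).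
  by apply: (@near_eq_cvg _ _ (nbhs x)); apply: filterS (nfg x Ax) => y ->.
- by apply: near_eq_is_derive (nfg x Ax) _; exact: C1_on_is_deriveP fA Ax.
- exact: C1_on_partial_continuous fA Ax.
Qed.

Lemma C1_on_cst A (c : R) : open A -> C1_on A (fun=> c).
Proof.
move=> oA; apply: (@C1_on_is_derive _ _ (fun _ _ => 0)) => // x *.
  exact: cst_continuous.
exact: cst_continuous.
Qed.

Lemma C1_onD A f g : open A -> C1_on A f -> C1_on A g ->
  C1_on A (fun x => f x + g x).
Proof.
move=> oA fA gA.
apply: (@C1_on_is_derive _ _ (fun k x => partial k f x + partial k g x))
  => // [x Ax|x k Ax|x k Ax].
- by apply: continuousD; [exact: C1_on_continuous fA Ax|exact: C1_on_continuous gA Ax].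
- by apply: is_deriveD; [exact: C1_on_is_deriveP fA Ax|exact: C1_on_is_deriveP gA Ax].
- by apply: continuousD; [exact: C1_on_partial_continuous fA Ax
                         |exact: C1_on_partial_continuous gA Ax].
Qed.

Lemma C1_onM A f g : open A -> C1_on A f -> C1_on A g ->
  C1_on A (fun x => f x * g x).
Proof.
move=> oA fA gA.
apply: (@C1_on_is_derive _ _
  (fun k x => f x * partial k g x + g x * partial k f x)) => // [x Ax|x k Ax|x k Ax].
- by apply: continuousM; [exact: C1_on_continuous fA Ax|exact: C1_on_continuous gA Ax].
- by apply: is_deriveM; [exact: C1_on_is_deriveP fA Ax|exact: C1_on_is_deriveP gA Ax].
- by apply: continuousD; apply: continuousM;
    [exact: C1_on_continuous fA Ax|exact: C1_on_partial_continuous gA Ax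
    |exact: C1_on_continuous gA Ax|exact: C1_on_partial_continuous fA Ax].
Qed.

Lemma C1_onV A f : open A -> (forall x, A x -> f x != 0) -> C1_on A f ->
  C1_on A (fun x => (f x)^-1).
Proof.
move=> oA f0 fA.
apply: (@C1_on_is_derive _ _
  (fun k x => - ((f x)^-1 * (f x)^-1) * partial k f x)) => // [x Ax|x k Ax|x k Ax].
- by apply: continuousV; [exact: f0|exact: C1_on_continuous fA Ax].
- have ? := C1_on_is_deriveP k fA Ax; rewrite -invfM -expr2.
  apply: DeriveDef; first by apply: derivableV; [exact: f0|exact: ex_derive].
  by rewrite deriveV ?f0// derive_val.
- have cV : {for x, continuous (fun x => (f x)^-1)}.
    by apply: continuousV; [exact: f0|exact: C1_on_continuous fA Ax].
  apply: continuousM; last exact: C1_on_partial_continuous fA Ax.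
  by apply: continuousN; exact: continuousM.
Qed.

Lemma C1_onN A f : open A -> C1_on A f -> C1_on A (fun x => - f x).
Proof.
move=> oA fA; apply: (@eq_C1_on _ (fun x => -1 * f x)) => //.
  by move=> x _; rewrite mulN1r.
by apply: C1_onM => //; exact: C1_on_cst.
Qed.

Lemma C1_on_sum A (J : Type) (r : seq J) (P : pred J) (F : J -> 'rV[R]_n -> R) :
  open A -> (forall j, C1_on A (F j)) ->
  C1_on A (fun x => \sum_(j <- r | P j) F j x).
Proof.
move=> oA FA; elim: r => [|j r ih].
  by apply: (eq_C1_on oA _ (C1_on_cst (0 : R) oA)) => x _; rewrite big_nil.
case Pj: (P j).
  by apply: (eq_C1_on oA _ (C1_onD oA (FA j) ih)) => x _; rewrite big_cons Pj.
by apply: (eq_C1_on oA _ ih) => x _; rewrite big_cons Pj.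
Qed.

Lemma C1_on_prod A (J : Type) (r : seq J) (P : pred J) (F : J -> 'rV[R]_n -> R) :
  open A -> (forall j, C1_on A (F j)) ->
  C1_on A (fun x => \prod_(j <- r | P j) F j x).
Proof.
move=> oA FA; elim: r => [|j r ih].
  by apply: (eq_C1_on oA _ (C1_on_cst (1 : R) oA)) => x _; rewrite big_nil.
case Pj: (P j).
  apply: (eq_C1_on oA _ (C1_onM oA (FA j) ih)) => x _.
  by rewrite big_cons Pj.
by apply: (eq_C1_on oA _ ih) => x _; rewrite big_cons Pj.
Qed.

Lemma C1_on_det A m (F : 'rV[R]_n -> 'M[R]_m) : open A ->
  (forall i j, C1_on A (fun x => F x i j)) -> C1_on A (fun x => \det (F x)).
Proof.
move=> oA FA; apply: C1_on_sum => // s; apply: C1_onM => //.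
  exact: C1_on_cst.
exact: C1_on_prod.
Qed.

(** Cramer's rule writes the entries as quotients of determinants. This is what makes gradients
    $C^1$, since they involve the inverse Gram matrix. *)
Lemma C1_on_invmx A m (F : 'rV[R]_n -> 'M[R]_m) : open A ->
  (forall i j, C1_on A (fun x => F x i j)) ->
  (forall x, A x -> F x \in unitmx) ->
  forall i j, C1_on A (fun x => invmx (F x) i j).
Proof.
move=> oA FA uF i j.
apply: (@eq_C1_on _ (fun x => (\det (F x))^-1 * cofactor (F x) j i)) => //.
  by move=> x Ax; rewrite /invmx uF// !mxE.
apply: C1_onM => //.
  apply: C1_onV => //; last exact: C1_on_det.
  by move=> x /uF; rewrite unitmxE unitfE.
apply: C1_onM => //; first exact: C1_on_cst.
apply: C1_on_det => // a b.
apply: (@eq_C1_on _ (fun x => F x (lift j a) (lift i b))) => // x _.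
by rewrite !mxE.
Qed.

Lemma smooth_on_C1 A f : smooth_on A f -> C1_on A f.
Proof.
move=> fA x Ax; split; first by have [] := fA [::] x Ax.
move=> k; have [_ /(_ k)] := fA [::] x Ax.
by have [] := fA [:: k] x Ax.
Qed.

Lemma smooth_on_partial A f k : smooth_on A f -> smooth_on A (partial k f).
Proof. by move=> fA s x Ax; have := fA (rcons s k) x Ax; rewrite foldr_rcons. Qed.

Lemma smooth_on_cst A (c : R) : smooth_on A (fun=> c).
Proof.
move=> s x _; suff [d ->] : exists d : R, foldr partial (fun=> c) s = fun=> d.
  by split=> [|k]; [exact: cst_continuous|exact: derivable_cst].
elim: s => [|k s [d sd]]; first by exists c.
by exists 0; apply/funext => y /=; rewrite sd /partial derive_cst.
Qed.

End C1.

(** * Continuous partial derivatives imply differentiability; the chain rule *)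

Section Differentiability.
Context {R : realType}.

(** The differential of a function whose gradient is the row [c]; the linear structure declared
    below lets [diff_unique] identify it. *)
Definition linear_form n (c : 'rV[R]_n) (v : 'rV[R]_n) : R :=
  \sum_k v 0 k * c 0 k.

Fact linear_form_is_linear n (c : 'rV[R]_n) : linear (linear_form c).
Proof.
move=> a u v; rewrite /linear_form scaler_sumr -big_split/=; apply: eq_bigr => k _.
by rewrite !mxE mulrDl -mulrA.
Qed.

HB.instance Definition _ n (c : 'rV[R]_n) :=
  GRing.isLinear.Build R 'rV[R]_n R _ (linear_form c) (linear_form_is_linear c).

Lemma linear_form_continuous n (c : 'rV[R]_n) : continuous (linear_form c).
Proof.
rewrite /linear_form => x; elim: (index_enum _) => [|k r ih].
  rewrite [X in continuous_at _ X](_ : _ = cst 0); first exact: cst_continuous.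
  by apply/funext => v; rewrite big_nil.
rewrite [X in continuous_at _ X](_ : _ =
  (fun v : 'rV[R]_n => v 0 k * c 0 k) + (fun v : 'rV[R]_n => \sum_(k <- r) v 0 k * c 0 k)).
  apply: continuousD; last exact: ih.
  by apply: continuousM; [exact: coord_continuous|exact: cst_continuous].
by apply/funext => v; rewrite big_cons.
Qed.

Lemma norm_coord_le n (x : 'rV[R]_n) k : `|x 0 k| <= `|x|.
Proof.
rewrite [leRHS]/Num.Def.normr/= mx_normrE.
exact: (le_bigmax _ (fun ij => `|x ij.1 ij.2|) (0, k)).
Qed.

Lemma norm_rV_le n (x : 'rV[R]_n) (e : R) : 0 <= e ->
  (forall k, `|x 0 k| <= e) -> `|x| <= e.
Proof.
move=> e0 xe; rewrite [leLHS]/Num.Def.normr/= mx_normrE; apply: bigmax_le => // -[i k] _ /=.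
by rewrite ord1.
Qed.

Lemma is_derive_line n (f : 'rV[R]_n -> R) (y v : 'rV[R]_n) (s d : R) :
  is_derive (y + s *: v) v f d ->
  is_derive s 1 (fun s => f (y + s *: v)) d.
Proof.
have E : (fun h => h^-1 *: (((fun s => f (y + s *: v)) \o shift s) (h *: 1) - f (y + s *: v)))
   = (fun h => h^-1 *: ((f \o shift (y + s *: v)) (h *: v) - f (y + s *: v))).
  apply/funext => h /=; congr (_ *: (f _ - _)).
  by rewrite [h%:A]mulr1 scalerDl addrCA.
by move=> [f1 f2]; apply: DeriveDef; [rewrite /derivable E|rewrite /derive E].
Qed.

(** Mean value theorem along the segment from [y] in direction [k], for [h] of either sign. The
    constant [c] is free: a partial derivative at a base point gives the first-order estimate for
    differentiability, and [c = 0] bounds difference quotients. *)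
Lemma partial_MVT n (f : 'rV[R]_n -> R) k (y : 'rV[R]_n) (h c e : R) :
  (forall s, `|s| <= `|h| -> derivable f (y + s *: basis_vec k) (basis_vec k)) ->
  (forall s, `|s| <= `|h| -> `|partial k f (y + s *: basis_vec k) - c| <= e) ->
  `|f (y + h *: basis_vec k) - f y - h * c| <= e * `|h|.
Proof.
move=> df fe.
pose g s := f (y + s *: basis_vec k).
have dg s : `|s| <= `|h| -> is_derive s (1 : R) g (partial k f (y + s *: basis_vec k)).
  by move=> sh; apply: is_derive_line; apply: derivableP; exact: df.
have cg a b : (forall s, s \in `[a, b]%R -> `|s| <= `|h|) -> {within `[a, b], continuous g}.
  move=> ab; apply: derivable_within_continuous => s sab.
  by have [] := dg _ (ab _ sab).
have g0 : f y = g 0 by rewrite /g scale0r addr0.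
rewrite g0 -/(g h).
have key d : `|d| <= `|h| ->
  g h - g 0 = partial k f (y + d *: basis_vec k) * h -> `|g h - g 0 - h * c| <= e * `|h|.
  move=> dh ->; rewrite mulrC -mulrBr normrM mulrC ler_wpM2r//; exact: fe.
have [h0|h0] := leP 0 h.
- have hs s : s \in `[0, h]%R -> `|s| <= `|h|.
    by rewrite in_itv/= => /andP[s0 sh]; rewrite !ger0_norm.
  have [s||d d0 dE] := @MVT_segment _ g (fun s => partial k f (y + s *: basis_vec k)) _ _ h0.
  + by move=> s0; apply: dg; apply: hs; exact: subset_itv_oo_cc.
  + exact: cg.
  + by apply: (key d); [exact: hs|rewrite dE subr0].
- have hs s : s \in `[h, 0]%R -> `|s| <= `|h|.
    by rewrite in_itv/= => /andP[s0 sh]; rewrite !ler0_norm ?lerN2// ltW.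
  have [s||d d0 dE] := @MVT_segment _ g (fun s => partial k f (y + s *: basis_vec k)) _ _ (ltW h0).
  + by move=> s0; apply: dg; apply: hs; exact: subset_itv_oo_cc.
  + exact: cg.
  + by apply: (key d); [exact: hs|rewrite -opprB dE sub0r mulrN opprK].
Qed.

(** The corners of the staircase from 0 to [v] that changes one coordinate at a time. *)
Definition truncate n (j : nat) (v : 'rV[R]_n) : 'rV[R]_n :=
  \row_k (if (k < j)%N then v 0 k else 0).

Lemma truncateS n (j : 'I_n) (v : 'rV[R]_n) :
  truncate j.+1 v = truncate j v + v 0 j *: basis_vec j.
Proof.
apply/rowP => k; rewrite !mxE/= ltnS leq_eqVlt eq_sym.
have [/val_inj ->|kj] /= := eqVneq (j : nat) k; first by rewrite ltnn eqxx mulr1 add0r.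
rewrite (_ : (k == j) = false) ?mulr0 ?addr0//.
by apply/negbTE; apply: contra kj => /eqP ->.
Qed.

Lemma C1_on_differentiable_subproof n (A : set 'rV[R]_n) f x : open A -> C1_on A f -> A x ->
  f \o shift x = cst (f x) + linear_form (\row_k partial k f x) +o_ (0 : 'rV[R]_n) id.
Proof.
move=> oA fA Ax; apply/eqaddoP => _/posnumP[e].
(* Each of the [n] stairs contributes an error of at most [d] times the norm of [v]. Dividing by
   [n.+1] keeps the sum below [e] and covers [n = 0]. *)
set d := e%:num / n.+1%:R.
have d0 : 0 < d by rewrite divr_gt0.
have [r /= r0 rP] : exists2 r : R, 0 < r & forall y, ball x r y ->
    A y /\ forall k, `|partial k f y - partial k f x| <= d.
  have : \forall y \near x, A y /\ forall k, `|partial k f y - partial k f x| <= d.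
    apply: filterI; first exact: open_nbhs_nbhs.
    have := @filter_forall _ _ (fun (k : 'I_n) y => `|partial k f y - partial k f x| <= d) (nbhs x) _.
    apply => k.
    have /cvgrPdist_le/(_ d d0) := C1_on_partial_continuous (k := k) fA Ax.
    by apply: filterS => y; rewrite distrC.
  by move/nbhs_ballP => [r r0 rP]; exists r.
near=> v.
have vr : `|v| < r.
  near: v; rewrite -nbhs_nearE; apply/nbhs_ballP; exists r => //= v.
  by rewrite -ball_normE/= sub0r normrN.
(* The staircase stays in the ball: the norm is the maximum norm, and every coordinate of the
   displacement is a coordinate of [v], zero, or [s]. *)
have inr j s : `|s| <= `|v| -> forall k : 'I_n, (k = j :> nat) -> ball x r (x + truncate j v + s *: basis_vec k).
  move=> sv k kj; rewrite -ball_normE/= opprD addrA opprD addrA subrr sub0r -opprD normrN.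
  apply: le_lt_trans vr; apply: norm_rV_le => // i; rewrite !mxE/=.
  have [->|ik] := eqVneq i k; first by rewrite kj ltnn add0r mulr1.
  rewrite mulr0 addr0; case: ifP => _; first exact: norm_coord_le.
  by rewrite normr0.
have -> : (f \o shift x - (cst (f x) + linear_form (\row_k partial k f x))) v =
  \sum_(k < n) (f (x + truncate k v + v 0 k *: basis_vec k) - f (x + truncate k v) - v 0 k * partial k f x).
  have S : \sum_(k < n) (f (x + truncate k v + v 0 k *: basis_vec k) - f (x + truncate k v)) = f (x + v) - f x.
    pose u j := f (x + truncate j v).
    rewrite (eq_bigr (fun k : 'I_n => u k.+1 - u k)); last first.
      by move=> k _; rewrite /u truncateS addrA.
    rewrite -(big_mkord xpredT (fun k => u k.+1 - u k)) telescope_sumr// /u.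
    congr (f (x + _) - f _).
      by apply/rowP => k; rewrite mxE ltn_ord.
    by apply/rowP => k; rewrite !mxE ltn0 addr0.
  rewrite sumrB S !fctE/= [v + x]addrC opprD addrA; congr (_ - _).
  by rewrite /linear_form; apply: eq_bigr => k _; rewrite mxE.
apply: (le_trans (ler_norm_sum _ _ _)).
apply: (@le_trans _ _ (\sum_(k < n) d * `|v|)).
  apply: ler_sum => k _.
  apply: le_trans (_ : d * `|v 0 k| <= _); last first.
    by rewrite ler_wpM2l ?(ltW d0)//; exact: norm_coord_le.
  apply: partial_MVT => s sv.
    have /rP[Ay _] := inr k s (le_trans sv (norm_coord_le _ _)) k erefl.
    exact: C1_on_derivable fA Ay.
  by have /rP[_] := inr k s (le_trans sv (norm_coord_le _ _)) k erefl; apply.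
rewrite sumr_const card_ord -mulrnAl /= ler_wpM2r//.
by rewrite -(mulr_natr d) /d mulrAC ler_pdivrMr// ler_wpM2l// ler_nat.
Unshelve. all: by end_near. Qed.

Lemma C1_on_differentiable n (A : set 'rV[R]_n) f x : open A -> C1_on A f -> A x ->
  differentiable f x.
Proof.
move=> oA fA Ax; have fE := C1_on_differentiable_subproof oA fA Ax.
apply/diff_locallyP.
have -> := diff_unique (@linear_form_continuous _ _) fE.
by split => //; exact: linear_form_continuous.
Qed.

Lemma differentiable_rV n m (T : 'rV[R]_n -> 'rV[R]_m) x :
  (forall l, differentiable (fun y => T y 0 l) x) -> differentiable T x.
Proof.
move=> Tx; rewrite (_ : T = \sum_(l < m) (fun y => T y 0 l *: (delta_mx 0 l : 'rV[R]_m))).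
  apply: differentiable_sum => l.
  exact: (@differentiableZl _ _ _ (fun y => T y 0 l)).
by apply/funext => y; rewrite fct_sumE -row_sum_delta.
Qed.

Lemma partial_comp n m (f : 'rV[R]_m -> R) (T : 'rV[R]_n -> 'rV[R]_m) x k :
  differentiable T x -> differentiable f (T x) ->
  partial k (f \o T) x = \sum_l 'J T x k l * partial l f (T x).
Proof.
move=> dT df; rewrite /partial deriveE; last exact: differentiable_comp.
rewrite diff_comp//= [X in 'd f (T x) X]row_sum_delta linear_sum.
apply: eq_bigr => l _; rewrite linearZ/=; congr (_ * _); last by rewrite deriveE.
by rewrite /jacobian mxE.
Qed.

End Differentiability.

(** * Slices of $\mathbb{R}\times\mathbb{R}^n$ at a fixed first coordinate *)

Section Slices.
Context {R : realType} {n : nat}.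
Implicit Types (F : 'rV[R]_(1 + n) -> R) (t : R) (x : 'rV[R]_n).

(** It serves twice: as the space-time point of [smooth_time_fun], and as the slice over the first
    coordinate in [lebesgue_integral_rV]. *)
Definition at_time t x : 'rV[R]_(1 + n) := row_mx (t%:M : 'rV[R]_1) x.

Lemma at_time_addr t x v :
  row_mx 0 v + at_time t x = at_time t (v + x).
Proof. by rewrite /at_time add_row_mx add0r. Qed.

Lemma at_time_addl h t x :
  row_mx (h%:M : 'rV[R]_1) 0 + at_time t x = at_time (h + t) x.
Proof. by rewrite /at_time add_row_mx add0r -raddfD. Qed.

Lemma basis_vec_rshift h (k : 'I_n) :
  h *: basis_vec (rshift 1 k) = row_mx 0 (h *: basis_vec k) :> 'rV[R]_(1 + n).
Proof. apply/rowP => j; rewrite mxE [RHS]mxE; case: splitP => i ji; rewrite !mxE.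
  by rewrite (_ : j = lshift n i) ?eq_lrshift/= ?mulr0//; exact: val_inj.
by rewrite (_ : j = rshift 1 i) ?eq_rshift//; exact: val_inj. Qed.

Lemma basis_vec_lshift h :
  h *: basis_vec (lshift n 0) = row_mx (h%:M : 'rV[R]_1) 0 :> 'rV[R]_(1 + n).
Proof.
apply/rowP => j; rewrite mxE [RHS]mxE; case: splitP => i ji; rewrite !mxE.
  have -> : j = lshift n 0 by apply: val_inj; rewrite /= ji ord1.
  by rewrite (ord1 i) !eqxx mulr1.
by rewrite (_ : j = rshift 1 i) ?eq_rlshift/= ?mulr0//; exact: val_inj.
Qed.

Lemma partial_at_time F t k :
  partial k (fun x => F (at_time t x)) = (fun x => partial (rshift 1 k) F (at_time t x)).
Proof.
apply/funext => x; rewrite /partial /derive.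
congr (lim (_ @ 0^')); apply/funext => h /=.
by rewrite basis_vec_rshift at_time_addr.
Qed.

Lemma derivable_at_time F t x k :
  derivable F (at_time t x) (basis_vec (rshift 1 k)) ->
  derivable (fun x => F (at_time t x)) x (basis_vec k).
Proof.
rewrite /derivable; under eq_fun => h do rewrite /= basis_vec_rshift at_time_addr.
exact.
Qed.

Lemma is_derive_at_time F t x :
  derivable F (at_time t x) (basis_vec (lshift n 0)) ->
  is_derive t 1 (fun s => F (at_time s x)) (partial (lshift n 0) F (at_time t x)).
Proof.
have E : (fun h => h^-1 *: ((F \o shift (at_time t x)) (h *: basis_vec (lshift n 0)) - F (at_time t x)))
   = (fun h => h^-1 *: (((fun s => F (at_time s x)) \o shift t) (h *: (1:R)) - F (at_time t x))).
  by apply/funext => h /=; rewrite basis_vec_lshift at_time_addl [h%:A]mulr1.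
rewrite /derivable E => dF; apply: DeriveDef => //.
by rewrite /partial /derive E.
Qed.

Lemma at_time_continuous t x : {for (t, x), continuous (fun z : R * 'rV[R]_n => at_time z.1 z.2)}.
Proof.
apply/cvgrPdist_lt => e e0; near=> z.
apply: (@le_lt_trans _ _ (Num.max `|t - z.1| `|x - z.2|)).
  apply: norm_rV_le => [|j]; first by rewrite le_max normr_ge0.
  rewrite !mxE; case: splitP => i _; rewrite le_max.
    by rewrite !mxE ord1 eqxx !mulr1n lexx.
  by rewrite (_ : x 0 i - z.2 0 i = (x - z.2) 0 i) ?norm_coord_le ?orbT// !mxE.
rewrite gt_max; apply/andP; split; near: z.
  have /cvgrPdist_lt/(_ e e0) : z.1 @[z --> (t, x)] --> t by exact: cvg_fst.
  exact.
have /cvgrPdist_lt/(_ e e0) : z.2 @[z --> (t, x)] --> x by exact: cvg_snd.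
exact.
Unshelve. all: by end_near. Qed.

(** An iterated partial derivative of the slice is the slice of the iterated partial derivative of
    [F] in the directions shifted by one. *)
Lemma smooth_on_slice (I : set R) (A : set 'rV[R]_n) F t : I t ->
  smooth_on [set z : 'rV[R]_(1 + n) | I (lsubmx z 0 0) /\ A (rsubmx z)] F ->
  smooth_on A (fun x => F (at_time t x)).
Proof.
move=> It FA s x Ax.
have -> : foldr partial (fun x => F (at_time t x)) s =
    (fun x => foldr partial F (map (@rshift 1 n) s) (at_time t x)).
  by elim: s => [//|k s ih] /=; rewrite ih partial_at_time.
have [|cF dF] := FA (map (@rshift 1 n) s) (at_time t x).
  by rewrite /at_time /= row_mxKl row_mxKr !mxE eqxx mulr1n.
split=> [|k]; last by apply: derivable_at_time; exact: dF.
apply: (@continuous_comp _ _ _ (at_time t) _ x) cF.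
apply: (@continuous_comp _ _ _ (fun x => (t, x)) (fun z => at_time z.1 z.2) x).
  move=> P [[P1 P2] /= [P1t P2x] subP]; apply: filterS P2x => y P2y; apply: subP.
  by split => //=; exact: nbhs_singleton P1t.
exact: at_time_continuous.
Qed.

End Slices.

(** * A piecewise polynomial $C^1$ cutoff on $\mathbb{R}^n$ *)

Section Plateau.
Context {R : realType} {n : nat}.

(** The square of the positive part, the simplest $C^1$ function that vanishes on a half-line and
    not beyond it. *)
Definition sqpos (u : R) : R := Num.max u 0 * u.

Lemma is_derive_sqpos u : is_derive u (1 : R) sqpos (2 * Num.max u 0).
Proof.
have [u0|u0|->] := ltgtP u 0.
- apply: (@near_eq_is_derive _ _ _ (cst 0)).
    near=> v; rewrite /sqpos /cst max_r ?mul0r//; near: v.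
    by apply: filterS (lt_nbhsl u0) => v /ltW.
  by rewrite mulr0; exact: is_derive_cst.
- apply: (@near_eq_is_derive R R R (fun v : R => v * v)).
    near=> v; rewrite /sqpos max_l//; near: v.
    by apply: filterS (lt_nbhsr u0) => v /ltW.
  rewrite (_ : (fun v : R => v * v) = (@id R : R -> R) * (@id R)); last by [].
  apply: is_derive_eq.
  by rewrite -[_ *: _]/(u * 1) mulr1 mulr_natl mulr2n.
(* At the corner the difference quotient is exactly the positive part of [h], which tends to 0. *)
- have H : h^-1 *: (sqpos (h + 0) - sqpos 0) @[h --> (0:R)^'] --> (0 : R).
    have M : Num.max (h : R) 0 @[h --> (0 : R)^'] --> (0 : R).
      have : {for (0 : R), continuous ((@id R : R -> R^o) \max cst 0)}.
        by apply: continuous_max; [exact: cvg_id|exact: cst_continuous].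
      by rewrite /prop_for /continuous_at/= maxxx; exact: cvg_within_filter.
    apply: cvg_trans M; apply: near_eq_cvg; near=> h.
    rewrite /sqpos addr0 mulr0 subr0 [_ *: _]mulrCA mulVf ?mulr1//.
    by near: h; exact: nbhs_dnbhs_neq.
  have E : (fun h => h^-1 *: (((sqpos \o shift 0) (h *: 1)) - sqpos 0)) = (fun h : R => h^-1 *: (sqpos (h + 0) - sqpos 0)).
    by apply/funext => h /=; rewrite [h%:A]mulr1.
  rewrite mulr0; apply: DeriveDef.
    by rewrite /derivable E; apply/cvg_ex; exists 0.
  by rewrite /derive E; exact: cvg_lim H.
Unshelve. all: by end_near. Qed.

Lemma C1_on_sqpos (A : set 'rV[R]_n) f : open A -> C1_on A f -> C1_on A (fun x => sqpos (f x)).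
Proof.
move=> oA fA.
have csq : continuous sqpos.
  by move=> u; apply/differentiable_continuous/derivable1_diffP; have [] := is_derive_sqpos u.
apply: (@C1_on_is_derive _ _ _ _ (fun k x => 2 * Num.max (f x) 0 * partial k f x)) => //.
- by move=> x Ax; apply: continuous_comp; [exact: C1_on_continuous fA Ax|exact: csq].
- move=> x k Ax.
  have [d1 d2] := is_derive_sqpos (f x).
  have df := C1_on_differentiable oA fA Ax.
  have dsq : differentiable sqpos (f x) by exact/derivable1_diffP.
  apply: DeriveDef; first by apply: diff_derivable; exact: differentiable_comp.
  rewrite deriveE; last exact: differentiable_comp.
  rewrite diff_comp//= diff1E// derive1E d2 -deriveE//.
  by rewrite [LHS]mulrC.
- move=> x k Ax; apply: continuousM; last exact: C1_on_partial_continuous fA Ax.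
  apply: continuousM; first exact: cst_continuous.
  by apply: continuous_max; [exact: C1_on_continuous fA Ax|exact: cst_continuous].
Qed.

(** Composing [sqpos] with itself, reflected, gives a $C^1$ transition from 0 to 1: the inner term
    $1-(u^+)^2$ is 1 for $u\le 0$ and nonpositive for $u\ge 1$. *)
Definition smoothstep (u : R) : R := 1 - sqpos (1 - sqpos u).

Lemma smoothstep0 u : u <= 0 -> smoothstep u = 0.
Proof.
by move=> u0; rewrite /smoothstep /sqpos (max_r u0) mul0r subr0 max_l// mulr1 subrr.
Qed.

Lemma smoothstep1 u : 1 <= u -> smoothstep u = 1.
Proof.
move=> u1; rewrite /smoothstep; set v := 1 - sqpos u.
suff v0 : v <= 0 by rewrite /sqpos (max_r v0) mul0r subr0.
rewrite /v /sqpos max_l ?(le_trans _ u1)// subr_le0.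
by rewrite -[leLHS]mulr1 ler_pM.
Qed.

(** The Euclidean squared distance is used because the norm of ['rV[R]_n] is the maximum norm, which
    is not $C^1$ in general. *)
Definition sqdist (a x : 'rV[R]_n) : R := \sum_k (x 0 k - a 0 k) * (x 0 k - a 0 k).

(** It is 1 where [r * sqdist a x] is at most 1 and 0 where it is at least 2. *)
Definition plateau (a : 'rV[R]_n) (r : R) (x : 'rV[R]_n) : R :=
  smoothstep (2 - r * sqdist a x).

Lemma C1_on_coord (A : set 'rV[R]_n) k : open A -> C1_on A (fun x => x 0 k).
Proof.
move=> oA; apply: (@C1_on_is_derive _ _ _ _ (fun l _ => (l == k)%:R)) => //.
- by move=> x _; exact: coord_continuous.
- move=> x l _; have := differentiable_coord x 0 k.
  move=> dx; apply: DeriveDef; first exact: diff_derivable.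
  have dl : derivable (@id 'rV[R]_n) x (basis_vec l) by exact: derivable_id.
  have := derive_mx dl; rewrite derive_id => /matrixP/(_ 0 k).
  by rewrite !mxE eqxx/= eq_sym => ->.
- by move=> x l _; exact: cst_continuous.
Qed.

Lemma C1_on_sqdist (A : set 'rV[R]_n) a : open A -> C1_on A (sqdist a).
Proof.
move=> oA; apply: C1_on_sum => // k.
have ck : C1_on A (fun x => x 0 k - a 0 k).
  by apply: C1_onD => //; [exact: C1_on_coord|exact: C1_on_cst].
exact: C1_onM.
Qed.

Lemma sqdist_continuous a : continuous (sqdist a).
Proof. by move=> x; exact: C1_on_continuous (@C1_on_sqdist setT a openT) I. Qed.

Lemma sqdistxx a : sqdist a a = 0.
Proof. by rewrite /sqdist big1// => k _; rewrite subrr mul0r. Qed.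

Lemma sqr_coord_le_sqdist (a x : 'rV[R]_n) k : (x 0 k - a 0 k) ^+ 2 <= sqdist a x.
Proof.
by rewrite /sqdist (bigD1 k)//= expr2 lerDl sumr_ge0// => l _; rewrite -expr2 sqr_ge0.
Qed.

Lemma C1_on_plateau (A : set 'rV[R]_n) a r : open A -> C1_on A (plateau a r).
Proof.
move=> oA; rewrite /plateau /smoothstep.
have c1 (c : R) : C1_on A (fun=> c) by exact: C1_on_cst.
apply: C1_onD => //; apply: C1_onN => //; apply: C1_on_sqpos => //.
apply: C1_onD => //; apply: C1_onN => //; apply: C1_on_sqpos => //.
apply: C1_onD => //; apply: C1_onN => //; apply: C1_onM => //.
exact: C1_on_sqdist.
Qed.

End Plateau.

(** * Borel measurability and the countable base of rational cubes *)

Section Borel.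

Lemma open_borel (T : ptopologicalType) (A : set T) :
  open A -> measurable (A : set (borel T)).
Proof. exact: sub_sigma_algebra. Qed.

Lemma closed_borel (T : ptopologicalType) (A : set T) :
  closed A -> measurable (A : set (borel T)).
Proof. by move=> cA; rewrite -[A]setCK; apply: measurableC; apply: open_borel; exact: closed_openC. Qed.

Lemma open_setI_preimage (T U : topologicalType) (A : set T) (f : T -> U) (O : set U) :
  open A -> (forall x, A x -> {for x, continuous f}) -> open O -> open (A `&` f @^-1` O).
Proof.
move=> oA cf oO; rewrite openE => x [Ax Ofx]; apply: filterI.
  exact: open_nbhs_nbhs.
by apply: (cf x Ax); exact: open_nbhs_nbhs.
Qed.

Lemma continuous_on_borel (T U : ptopologicalType) (A : set T) (f : T -> U) :
  open A -> (forall x, A x -> {for x, continuous f}) ->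
  measurable_fun (A : set (borel T)) (f : borel T -> borel U).
Proof.
move=> oA cf; have E : @measurable _ (borel U) = <<s @open U >> by [].
apply: (measurability _ E) => // _ [V oV <-].
by apply: open_borel; exact: open_setI_preimage.
Qed.

Lemma continuous_on_measurable (R : realType) (T : ptopologicalType) (A : set T) (f : T -> R) :
  open A -> (forall x, A x -> {for x, continuous f}) ->
  measurable_fun (A : set (borel T)) (f : borel T -> R).
Proof.
move=> oA cf; apply: (measurability _ (RGenOpens.measurableE R)) => // _ [_ [a [b ->]] <-].
by apply: open_borel; apply: open_setI_preimage => //; exact: itv_open.
Qed.

Definition rat_ball {R : realType} {n} (i : 'rV[rat]_n * rat) : set 'rV[R]_n :=
  [set x | forall k, `|x 0 k - ratr (i.1 0 k)| < ratr i.2].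

Lemma open_rat_ball {R : realType} n (i : 'rV[rat]_n * rat) : open (@rat_ball R n i).
Proof.
rewrite openE => x xi.
apply: (@filter_forall _ _ (fun (k : 'I_n) (y : 'rV[R]_n) => `|y 0 k - ratr (i.1 0 k)| < ratr i.2) (nbhs x)) => k.
have : {for x, continuous (fun y : 'rV[R]_n => `|y 0 k - ratr (i.1 0 k)|)}.
  apply: continuous_comp; last exact: norm_continuous.
  by apply: continuousB; [exact: coord_continuous|exact: cst_continuous].
by move/(_ [set z | z < ratr i.2]); apply; exact: lt_nbhsl.
Qed.

(** Cubes that do not fit into [O] are replaced by the empty set, so that the union runs over a
    countable type. *)
Lemma open_bigcup_rat_ball (R : realType) n (O : set 'rV[R]_n) : open O ->
  O = \bigcup_i (if `[< rat_ball i `<=` O >] then rat_ball i else set0).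
Proof.
move=> oO; apply/seteqP; split => [x Ox|x [i _]]; last by case: asboolP => // iO /iO.
have /nbhs_ballP[e /= e0 eO] : nbhs x O by exact: open_nbhs_nbhs.
(* With [r] between [e / 4] and [e / 2] and a rational centre within [e / 4] of [x], the cube
   contains [x] and its points are within [e / 4 + e / 2 < e] of [x]. *)
have [r] : exists r, ratr r \in `](e / 4), (e / 2)[.
  by apply: rat_in_itvoo; rewrite ltr_pM2l// ltf_pV2 ?posrE// ltr_nat.
rewrite in_itv/= => /andP[r1 r2].
have e4 : 0 < e / 4 by rewrite divr_gt0.
have qk k : exists q, ratr q \in `](x 0 k - e / 4), (x 0 k + e / 4)[.
  by apply: rat_in_itvoo; rewrite ltrBlDr -addrA ltrDl addr_gt0.
pose q : 'rV[rat]_n := \row_k sval (cid (qk k)).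
have xq k : `|x 0 k - ratr (q 0 k)| < e / 4.
  rewrite mxE; case: cid => /= y; rewrite in_itv/= => /andP[y1 y2].
  by rewrite distrC ltr_distl y1.
exists (q, r) => //; case: asboolP => [?|]; first by move=> k /=; exact: lt_trans (xq k) r1.
case => y yqr; apply: eO; rewrite -ball_normE/=.
apply: (@le_lt_trans _ _ (e / 4 + e / 2)); last by lra.
apply: norm_rV_le => [|k]; first by rewrite addr_ge0// ltW// divr_gt0.
rewrite !mxE -(subrKA (ratr (q 0 k))).
apply: (le_trans (ler_normD _ _)); apply: lerD; first exact: ltW.
by rewrite distrC; apply: ltW; exact: lt_trans (yqr k) r2.
Qed.

(** The source carries the product sigma-algebra, so continuity does not settle the matter. An open
    set is a countable union of rational cubes, and the preimage of a cube is a measurable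
    rectangle. *)
Lemma measurable_row_mx (R : realType) n :
  measurable_fun [set: R * borel 'rV[R]_n]
    ((fun z => at_time z.1 z.2) : _ -> borel 'rV[R]_(1 + n)).
Proof.
have E : @measurable _ (borel 'rV[R]_(1 + n)) = <<s @open 'rV[R]_(1 + n) >> by [].
apply: (measurability _ E) => // _ [V oV <-].
rewrite setTI (open_bigcup_rat_ball oV) preimage_bigcup.
apply: countable_bigcupT_measurable; first exact: countableP.
move=> i; case: ifP => _; last by rewrite preimage_set0.
rewrite [X in measurable X](_ : _ =
   [set x : R | `|x - ratr (i.1 0 (lshift n 0))| < ratr i.2] `*`
   (rat_ball (rsubmx i.1, i.2) : set (borel 'rV[R]_n))).
  apply: measurableX; last by apply: open_borel; exact: open_rat_ball.
  rewrite (_ : mkset _ = ball (ratr (i.1 0 (lshift n 0)) : R) (ratr i.2)); first exact: measurable_ball.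
  by apply/seteqP; split=> x /=; rewrite -ball_normE/= distrC.
apply/seteqP; split => -[x y] /=.
  move=> H; split => [|k].
    by have := H (lshift n 0); rewrite row_mxEl mxE eqxx mulr1n.
  by have := H (rshift 1 k); rewrite row_mxEr !mxE.
move=> [H1 H2] k; rewrite mxE; case: splitP => j kj.
  by rewrite mxE (ord1 j) eqxx mulr1n (_ : k = lshift n 0)//; apply: val_inj; rewrite /= kj ord1.
have := H2 j; rewrite !mxE/= (_ : k = rshift 1 j)//; exact: val_inj.
Qed.

End Borel.

(** * Change of variables for a measure given by a density *)

Section Density.
Local Open Scope ereal_scope.
Import HBNNSimple.

(** On [D], [mu] is the image under [c] of the measure with density [h] against [lam]. The
    hypothesis is the case of indicators; linearity gives simple functions, and monotone convergence
    gives nonnegative measurable ones. The map [c] is total, and points that it sends outside [D]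
    have density 0. *)
Lemma ge0_integral_image_density d d' (T : measurableType d) (S : measurableType d')
    (R : realType) (mu : {measure set T -> \bar R}) (lam : {measure set S -> \bar R})
    (D : set T) (c : S -> T) (h : S -> R) :
  measurable D -> measurable_fun [set: S] c -> measurable_fun [set: S] h ->
  (forall y, (0 <= h y)%R) -> (forall y, ~ D (c y) -> h y = 0%R) ->
  (forall A, measurable A -> A `<=` D -> mu A = \int[lam]_y (\1_A (c y) * h y)%:E) ->
  forall g : T -> \bar R, measurable_fun D g -> (forall x, D x -> 0 <= g x) ->
  \int[mu]_(x in D) g x = \int[lam]_y (g (c y) * (h y)%:E).
Proof.
move=> mD mc mh h0 hD muE g mg g0.
have mind A : measurable A -> measurable_fun [set: S] (fun y => \1_A (c y) : R).
  move=> mA; rewrite (_ : (fun y => _) = \1_(c @^-1` A)); last by [].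
  by apply: measurable_indic; rewrite -[X in measurable X]setTI; exact: mc.
have mEh : measurable_fun [set: S] (EFin \o h) by exact/measurable_EFinP.
pose g_ := nnsfun_approx mD mg.
have gc y : D y -> (g_ n y)%:E @[n --> \oo] --> g y.
  by move=> Dy; apply: cvg_nnsfun_approx => // *; exact: g0.
have mgn n : measurable_fun [set: S] (fun y => (g_ n (c y))%:E).
  by apply/measurable_EFinP; apply: measurableT_comp.
transitivity (limn (fun n => \int[mu]_(x in D) (g_ n x)%:E)).
  rewrite -monotone_convergence//.
  - by apply: eq_integral => y /set_mem yD; apply/esym/cvg_lim => //; exact: gc.
  - by move=> n; exact/measurable_EFinP/measurable_funTS.
  - by move=> n y _; rewrite lee_fin.
  - by move=> y _ m n mn; rewrite lee_fin; exact/lefP/nd_nnsfun_approx.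
transitivity (limn (fun n => \int[lam]_y ((g_ n (c y))%:E * (h y)%:E))); last first.
  rewrite -monotone_convergence//.
  - apply: eq_integral => y _; apply/cvg_lim => //.
    have [Dy|nDy] := pselect (D (c y)); last first.
      by rewrite hD// mule0; under eq_fun do rewrite mule0; exact: cvg_cst.
    by apply: cvgeZr => //; exact: gc.
  - by move=> n; exact: emeasurable_funM.
  - by move=> n y _; rewrite mule_ge0// lee_fin.
  - by move=> y _ m n mn; rewrite lee_wpmul2r// lee_fin//; exact/lefP/nd_nnsfun_approx.
congr (limn _); apply/funext => n.
have mpre r : measurable (g_ n @^-1` [set r]) by [].
transitivity (\sum_(k \in range (g_ n))
    \int[mu]_(x in D) (k * \1_(g_ n @^-1` [set k]) x)%:E).
  under eq_integral do rewrite fimfunE -fsumEFin//.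
  rewrite ge0_integral_fsum//.
  - by move=> y; exact/measurable_EFinP/measurable_funM.
  - by move=> y x _; rewrite nnfun_muleindic_ge0.
transitivity (\sum_(k \in range (g_ n))
    \int[lam]_y (k%:E * (\1_(g_ n @^-1` [set k] `&` D) (c y) * h y)%:E)).
  apply: eq_fsbigr => r _; rewrite integralZl_indic_nnsfun// integral_indic//=.
  rewrite muE//; last exact: measurableI.
  have [r0|r0] := ltP r 0%R.
    rewrite preimage_nnfun0// set0I; under eq_integral do rewrite indic0/= mul0r.
    by under [RHS]eq_integral do rewrite indic0/= mul0r mule0; rewrite !integral0 mule0.
  rewrite -ge0_integralZl//.
  - by apply/measurable_EFinP; apply: measurable_funM => //; apply: mind; exact: measurableI.
  - by move=> y _; rewrite lee_fin mulr_ge0.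
rewrite -ge0_integral_fsum//.
- apply: eq_integral => y _.
  have [Dy|nDy] := pselect (D (c y)); last first.
    by rewrite hD// mule0 fsbig1// => k _; rewrite mulr0 mule0.
  rewrite [in RHS]fimfunE -EFinM mulrC mulr_fsumr -fsumEFin//.
  apply: eq_fsbigr => r _; rewrite -EFinM; congr EFin.
  by rewrite !indicE in_setI (mem_set Dy) andbT [RHS]mulrC mulrA.
- move=> r; apply: emeasurable_funM => //; apply/measurable_EFinP.
  by apply: measurable_funM => //; apply: mind; exact: measurableI.
- move=> r y _; have [r0|r0] := ltP r 0%R.
    by rewrite preimage_nnfun0// set0I indic0 mul0r mule0.
  by rewrite mule_ge0// lee_fin mulr_ge0.
Qed.

End Density.

Section SigmaFiniteCopy.
Context d (T : measurableType d) (R : realType) (lam : {measure set T -> \bar R}).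

(* An alias of lam that carries its sigma-finiteness as a structure, as product
   measures require. *)
Definition sfinite_copy of sigma_finite setT lam : set T -> \bar R := lam.

Hypothesis sf : sigma_finite setT lam.

HB.instance Definition _ := Measure.copy (sfinite_copy sf) lam.

HB.instance Definition _ := Measure_isSigmaFinite.Build _ _ _ (sfinite_copy sf) sf.

End SigmaFiniteCopy.

(** * The iterated integral as integration against a Borel measure on $\mathbb{R}^n$ *)

Section LebesgueRV.
Context {R : realType}.
Local Open Scope ereal_scope.

(** Finiteness on balls gives sigma-finiteness, as Tonelli requires, and the integrability of
    bounded functions of bounded support. *)
Definition is_lebesgue_rV n (lam : {measure set (borel 'rV[R]_n) -> \bar R}) :=
  (forall k : nat, lam [set x | `|x : 'rV[R]_n|%R < k%:R]%R < +oo) /\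
  forall f : 'rV[R]_n -> \bar R, measurable_fun [set: borel 'rV[R]_n] f ->
    (forall x, 0 <= f x) -> lebesgue_integral_rV f = \int[lam]_x f x.

Lemma open_norm_lt n (b : R) : open [set x : 'rV[R]_n | `|x| < b]%R.
Proof.
by apply: (@open_comp _ _ (fun x : 'rV[R]_n => `|x|%R) [set r | (r < b)%R]);
  [move=> x _; exact: norm_continuous|exact: open_lt].
Qed.

Lemma is_lebesgue_rV_sigma_finite n lam : @is_lebesgue_rV n lam ->
  sigma_finite [set: borel 'rV[R]_n] lam.
Proof.
move=> [lamfin _]; exists (fun k => [set x | `|x : 'rV[R]_n| < k%:R]%R).
  apply/seteqP; split => // x _; exists (Num.bound `|x : 'rV[R]_n|) => //=.
  by apply: le_lt_trans (archi_boundP _) => //.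
by move=> k; split; [apply: open_borel; exact: open_norm_lt|exact: lamfin].
Qed.

Lemma measurable_at_time n (x : R) :
  measurable_fun [set: borel 'rV[R]_n] (at_time x : _ -> borel 'rV[R]_(1 + n)).
Proof. exact: (measurableT_comp (@measurable_row_mx R n) (pair1_measurable _)). Qed.

(** By induction on the dimension: the Dirac mass on the one-point space, then the image under
    [at_time] of the product with Lebesgue measure on the line. Tonelli unfolds the latter into the
    iterated integral. *)
Lemma lebesgue_integral_rV_measure n :
  exists lam : {measure set (borel 'rV[R]_n) -> \bar R}, is_lebesgue_rV lam.
Proof.
elim: n => [|n [lam lamP]].
  exists (@dirac _ (borel 'rV[R]_0) (0%R : 'rV[R]_0) R); split => [k|f mf f0].
    by rewrite /= /dirac indicE; case: (_ \in _); rewrite ltry.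
  by rewrite integral_dirac// diracE mem_set// mul1e.
have [lamfin lamE] := lamP.
pose lams := sfinite_copy (is_lebesgue_rV_sigma_finite lamP).
pose phi : R * borel 'rV[R]_n -> borel 'rV[R]_(1 + n) := fun z => at_time z.1 z.2.
have mphi : measurable_fun setT phi := @measurable_row_mx R n.
pose P : {measure set (measurableTypeR R * borel 'rV[R]_n)%type -> \bar R} :=
  (@lebesgue_measure R \x lams).
pose lam' : {measure set (borel 'rV[R]_(1 + n)) -> \bar R} :=
  measure_function_pushforward__canonical__measure_function_Measure P mphi.
exists lam'; split => [k|f mf f0].
  (* The components of a row of norm less than [k] have norm less than [k], so the ball pulls back
     into a rectangle of finite product measure. *)
  pose B := (ball (0%R : R) k%:R : set (measurableTypeR R)) `*`
            ([set x | `|x| < k%:R]%R : set (borel 'rV[R]_n)).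
  have mB : measurable B.
    by apply: measurableX; [exact: measurable_ball|apply: open_borel; exact: open_norm_lt].
  apply: (@le_lt_trans _ _ (P B)).
    apply: (@le_measure _ _ _ P); rewrite ?inE//.
      by rewrite -[X in measurable X]setTI; apply: (@measurable_row_mx R n) => //; apply: open_borel; exact: open_norm_lt.
    move=> [x y] /= xy; split => /=.
      rewrite -ball_normE/= sub0r normrN; apply: le_lt_trans xy.
      by have := norm_coord_le (at_time x y) (lshift n 0%R); rewrite /at_time row_mxEl mxE eqxx mulr1n.
    apply: le_lt_trans xy; apply: norm_rV_le => // i.
    by have := norm_coord_le (at_time x y) (rshift 1 i); rewrite /at_time row_mxEr.
  have -> : P B = lebesgue_measure (ball (0%R : R) k%:R) *
                  lams [set x : 'rV[R]_n | `|x| < k%:R]%R.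
    by apply: product_measure1E; [exact: measurable_ball|apply: open_borel; exact: open_norm_lt].
  by rewrite lebesgue_measure_ball// lte_mul_pinfty//; exact: lamfin.
rewrite (_ : \int[lam']_x f x = \int[P]_z f (phi z)); last first.
  by rewrite ge0_integral_pushforward.
rewrite fubini_tonelli1//; last exact: measurableT_comp.
apply: eq_integral => x _; rewrite /fubini_F/=.
rewrite -lamE//.
exact: (measurableT_comp mf (measurable_at_time _)).
Qed.

End LebesgueRV.

(** * Boundedness and integrability from compact support *)

Section BoundedSupport.
Local Open Scope ereal_scope.

Lemma integrable_bounded_support d (T : measurableType d) (R : realType)
    (mu : {measure set T -> \bar R}) (A : set T) (f : T -> R) (C : R) :
  measurable A -> mu A < +oo -> measurable_fun [set: T] f ->
  (forall x, (`|f x| <= C)%R) -> (forall x, ~ A x -> f x = 0%R) ->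
  mu.-integrable [set: T] (EFin \o f).
Proof.
move=> mA muA mf fC f0.
rewrite (_ : EFin \o f = (EFin \o f) \_ A).
  apply/(integrable_mkcond _ mA); apply: measurable_bounded_integrable => //.
    exact: measurable_funTS.
  by exists C; split => //= y Cy x _ /=; apply: le_trans (fC x) (ltW Cy).
by apply/funext => x; rewrite patchE; case: ifPn => //; rewrite notin_setE /= => /f0 ->.
Qed.

Lemma continuous_compact_bounded (T : topologicalType) (R : realType) (K : set T) (f : T -> R) :
  compact K -> (forall x, K x -> {for x, continuous f}) ->
  exists C, (0 <= C)%R /\ forall x, K x -> (`|f x| <= C)%R.
Proof.
move=> cK cf.
have : {within K, continuous f}.
  by apply: continuous_in_subspaceT => x /set_mem; exact: cf.
move=> /continuous_compact/(_ cK)/compact_bounded[M [_ HM]].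
exists (`|M| + 1)%R; split => [|x Kx]; first by rewrite addr_ge0.
by apply: HM; [rewrite (le_lt_trans (ler_norm _))// ltrDl|exists x].
Qed.

Lemma continuous_compact_support_bounded (T : topologicalType) (R : realType) (K : set T) (f : T -> R) :
  compact K -> continuous f -> (forall x, ~ K x -> f x = 0%R) ->
  exists C, forall x, (`|f x| <= C)%R.
Proof.
move=> cK cf f0; have [x _|C [C0 HC]] := @continuous_compact_bounded T R K f cK.
  exact: cf.
exists C => x; have [/HC//|/f0 ->] := pselect (K x); by rewrite normr0.
Qed.

End BoundedSupport.

(** * Translation invariance, and the vanishing integral of a partial derivative *)

Section LebesgueRVTheory.
Context {R : realType}.
Local Open Scope ereal_scope.

Lemma measurable_lebesgue_integral_rV n (f : 'rV[R]_(1 + n) -> \bar R) :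
  measurable_fun [set: borel 'rV[R]_(1 + n)] f -> (forall x, 0 <= f x) ->
  measurable_fun [set: R] (fun x => lebesgue_integral_rV (fun y : 'rV[R]_n => f (at_time x y))).
Proof.
move=> mf f0; have [lam lamP] := lebesgue_integral_rV_measure (R := R) n.
pose lams := sfinite_copy (is_lebesgue_rV_sigma_finite lamP).
rewrite (_ : (fun x => _) = fubini_F lams (fun z => f (at_time z.1 z.2))).
  apply: measurable_fun_fubini_tonelli_F => //.
  exact: (measurableT_comp mf (@measurable_row_mx R n)).
apply/funext => x; rewrite /fubini_F/= lamP.2//.
exact: (measurableT_comp mf (measurable_at_time _)).
Qed.

(** The image of Lebesgue measure under the translation gives half-open intervals their length,
    hence it is Lebesgue measure by uniqueness. *)
Lemma ge0_integral_lebesgue_shift (a : R) (f : R -> \bar R) :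
  measurable_fun [set: R] f -> (forall x, 0 <= f x) ->
  \int[lebesgue_measure]_x f (x + a)%R = \int[lebesgue_measure]_x f x.
Proof.
move=> mf f0.
pose phi : measurableTypeR R -> measurableTypeR R := fun x => (x + a)%R.
have mphi : measurable_fun setT phi by exact: measurable_funD.
pose P : {measure set (measurableTypeR R) -> \bar R} :=
  measure_function_pushforward__canonical__measure_function_Measure (@lebesgue_measure R) mphi.
transitivity (\int[P]_x f x).
  by rewrite (ge0_integral_pushforward mphi).
apply: eq_measure_integral => A mA _; apply/esym.
apply: lebesgue_measure_unique => // _ [[c b]] _ <-.
rewrite /P/= /pushforward (_ : phi @^-1` _ = `](c - a)%R, (b - a)%R]%classic).
  rewrite !lebesgue_measure_itv/= !lte_fin ltrD2r; case: ifP => // _.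
  by rewrite -!EFinB opprB addrA subrK.
by apply/seteqP; split => x; rewrite /= !in_itv/= /phi ltrBlDr lerBrDr.
Qed.

Lemma measurable_shift_rV n (v : 'rV[R]_n) :
  measurable_fun [set: borel 'rV[R]_n] ((fun x => x + v)%R : _ -> borel 'rV[R]_n).
Proof.
apply: continuous_on_borel; first exact: openT.
by move=> x _; apply: continuousD; [exact: cvg_id|exact: cst_continuous].
Qed.

Lemma lebesgue_integral_rV_ge0 n (f : 'rV[R]_n -> \bar R) :
  (forall x, 0 <= f x) -> 0 <= lebesgue_integral_rV f.
Proof. by elim: n f => [|n ih] f f0 //=; apply: integral_ge0 => x _; exact: ih. Qed.

(** One coordinate at a time: the induction hypothesis shifts the inner integral, and invariance on
    the line shifts the outer one. *)
Lemma lebesgue_integral_rV_shift n (v : 'rV[R]_n) (f : 'rV[R]_n -> \bar R) :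
  measurable_fun [set: borel 'rV[R]_n] f -> (forall x, 0 <= f x) ->
  lebesgue_integral_rV (fun x => f (x + v)%R) = lebesgue_integral_rV f.
Proof.
elim: n v f => [|n ih] v f mf f0; first by rewrite /= [v]thinmx0 addr0.
pose v' : 'rV[R]_(1 + n) := v.
pose a := lsubmx v' 0%R 0%R.
have atD x y : (at_time x y + v' = at_time (x + a) (y + rsubmx v'))%R.
  rewrite -[X in (_ + X)%R]hsubmxK /at_time add_row_mx; congr row_mx.
  by rewrite [lsubmx v']mx11_scalar -raddfD.
rewrite /=; under eq_integral => x _.
  rewrite (_ : (fun y : 'rV_n => _) = (fun y => f (at_time (x + a)%R (y + rsubmx v')%R))); last first.
    by apply/funext => y; rewrite -atD.
  rewrite (ih (rsubmx v') (fun y => f (at_time (x + a)%R y))); [|exact: (measurableT_comp mf (measurable_at_time _))|by []].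
over.
apply: (ge0_integral_lebesgue_shift _ (measurable_lebesgue_integral_rV mf f0)) => x.
exact: lebesgue_integral_rV_ge0.
Qed.

Lemma integral_shift n lam (v : 'rV[R]_n) (f : 'rV[R]_n -> \bar R) : @is_lebesgue_rV R n lam ->
  measurable_fun [set: borel 'rV[R]_n] f ->
  \int[lam]_x f (x + v)%R = \int[lam]_x f x.
Proof.
move=> [_ lamE] mf; rewrite [LHS]integralE [RHS]integralE.
have mp := measurable_funepos mf. have mn := measurable_funeneg mf.
have H (g : 'rV[R]_n -> \bar R) : measurable_fun [set: borel 'rV[R]_n] g -> (forall x, 0 <= g x) ->
    \int[lam]_x g (x + v)%R = \int[lam]_x g x.
  move=> mg g0; rewrite -(lamE g mg g0) -(lebesgue_integral_rV_shift v mg g0) lamE//.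
  exact: (measurableT_comp mg (measurable_shift_rV v)).
rewrite -(H _ mp); last by move=> x; exact: funepos_ge0.
rewrite -(H _ mn) => [|x]; last exact: funeneg_ge0.
by congr (_ - _); apply: eq_integral => x _; rewrite ?funeposE ?funenegE.
Qed.

Lemma integrable_lebesgue_rV n lam (f : 'rV[R]_n -> R) (C : R) (N : nat) : @is_lebesgue_rV R n lam ->
  measurable_fun [set: borel 'rV[R]_n] f -> (forall x, `|f x| <= C)%R ->
  (forall x, N%:R <= `|x| -> f x = 0)%R -> lam.-integrable [set: borel 'rV[R]_n] (EFin \o f).
Proof.
move=> [lamfin _] mf fC f0.
apply: (@integrable_bounded_support _ _ _ _ [set x : borel 'rV[R]_n | `|x : 'rV[R]_n| < N%:R]%R _ C) => //.
  by apply: open_borel; exact: open_norm_lt.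
by move=> x /= /negP; rewrite -leNgt => /f0.
Qed.

Lemma compact_norm_le n (b : R) : compact [set x : 'rV[R]_n | `|x| <= b]%R.
Proof.
apply: bounded_closed_compact.
  by exists b; split => //= c bc x /= /le_trans; apply; exact: ltW.
apply: (@closed_comp _ _ (fun x : 'rV[R]_n => `|x|%R) [set r | (r <= b)%R]).
  by move=> x _; exact: norm_continuous.
exact: closed_le.
Qed.

Lemma integral_partial_eq0 n lam (k : 'I_n) (F : 'rV[R]_n -> R) (b : R) : @is_lebesgue_rV R n lam ->
  C1_on setT F -> (forall x, b <= `|x| -> F x = 0)%R ->
  lam.-integrable [set: borel 'rV[R]_n] (EFin \o partial k F) /\
  \int[lam]_x (partial k F x)%:E = 0.
Proof.
move=> lamP F1 F0.
have cF : continuous F by move=> x; exact: (C1_on_continuous F1).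
have cdF : continuous (partial k F) by move=> x; exact: (C1_on_partial_continuous F1).
pose N := Num.bound `|b|%R.
have bN : (b <= N%:R)%R := le_trans (ler_norm b) (ltW (archi_boundP (normr_ge0 b))).
have F0N x : (N%:R <= `|x| -> F x = 0)%R by move=> /(le_trans bN); exact: F0.
(* The margin of 1 beyond [N] serves twice: here it leaves a neighbourhood on which [F] vanishes,
   and below it absorbs translations of length at most 1. *)
have dF0 x : (N.+1%:R <= `|x| -> partial k F x = 0)%R.
  move=> Nx; rewrite /partial (_ : 0%R = 'D_(basis_vec k) (cst (0%R : R)) x); last by rewrite derive_cst.
  apply: near_eq_derive; near=> y; apply: F0N; apply: ltW; near: y.
  have oN : open [set y : 'rV[R]_n | N%:R < `|y|]%R.
    by apply: (@open_comp _ _ (fun y : 'rV[R]_n => `|y|%R) [set r | (N%:R < r)%R]);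
      [move=> y _; exact: norm_continuous|exact: open_gt].
  by apply: open_nbhs_nbhs; split; rewrite //= (lt_le_trans _ Nx)// ltr_nat.
have [C1 FC1] : exists C, forall x, (`|F x| <= C)%R.
  apply: (continuous_compact_support_bounded (@compact_norm_le n N%:R) cF).
  by move=> x /= /negP; rewrite -ltNge => /ltW/F0N.
have [C dFC] : exists C, forall x, (`|partial k F x| <= C)%R.
  apply: (continuous_compact_support_bounded (@compact_norm_le n N.+1%:R) cdF).
  by move=> x /= /negP; rewrite -ltNge => /ltW/dF0.
have mF : measurable_fun [set: borel 'rV[R]_n] F.
  by apply: continuous_on_measurable; [exact: openT|move=> x _; exact: cF].
have mdF : measurable_fun [set: borel 'rV[R]_n] (partial k F).
  by apply: continuous_on_measurable; [exact: openT|move=> x _; exact: cdF].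
have iF : lam.-integrable [set: borel 'rV[R]_n] (EFin \o F).
  exact: (integrable_lebesgue_rV lamP mF FC1 F0N).
split; first exact: (integrable_lebesgue_rV lamP mdF dFC dF0).
have C0 : (0 <= C)%R := le_trans (normr_ge0 _) (dFC 0%R).
pose h (j : nat) : R := j.+1%:R^-1%R.
have h1 j : (`|h j| <= 1)%R by rewrite /h ger0_norm ?invr_ge0 ?ler0n// invf_le1 ?ltr0n// ler1n.
have e1 : (`|basis_vec k : 'rV[R]_n| <= 1)%R.
  by apply: norm_rV_le => // i; rewrite mxE normr_nat; case: (_ && _).
(* The difference quotients of F have integral 0 by translation invariance, and
   converge boundedly to the partial derivative. *)
pose f_ j x := (j.+1%:R * (F (x + h j *: basis_vec k) - F x))%R.
have mFh j : measurable_fun [set: borel 'rV[R]_n] (fun x => F (x + h j *: basis_vec k)%R).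
  exact: (measurableT_comp mF (measurable_shift_rV _)).
have f_0 j x : (N.+1%:R <= `|x| -> f_ j x = 0)%R.
  move=> Nx; rewrite /f_ !F0N ?subrr ?mulr0//.
    by rewrite (le_trans _ Nx)// ler_nat.
  have := ler_distD (x + h j *: basis_vec k)%R x 0%R; rewrite !subr0 opprD addrA subrr sub0r normrN normrZ => H.
  have : (`|h j| * `|basis_vec k : 'rV[R]_n| <= 1)%R by rewrite -[leRHS]mulr1 ler_pM.
  by move: Nx; rewrite -natr1; lra.
(* The mean value estimate with slope 0 bounds the difference quotients by the supremum of the
   partial derivative, uniformly in [j]. *)
have f_C j x : (`|f_ j x| <= C)%R.
  have := @partial_MVT R n F k x (h j) 0%R C.
  rewrite mulr0 subr0 => H; rewrite /f_ normrM (ger0_norm (ler0n _ _)) -ler_pdivlMl//.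
  apply: le_trans (H _ _) _.
  - by move=> s _; have [_ /(_ k)[]] := F1 (x + s *: basis_vec k)%R I.
  - by move=> s _; rewrite subr0.
  - by rewrite [leRHS]mulrC (ger0_norm (_ : 0 <= h j)%R)// /h invr_ge0.
have mf_ j : measurable_fun [set: borel 'rV[R]_n] (f_ j).
  by apply: measurable_funM => //; apply: measurable_funB.
pose g (x : 'rV[R]_n) : R := (C * \1_[set x : 'rV[R]_n | `|x| < N.+1%:R]%R x)%R.
have mA : measurable ([set x : 'rV[R]_n | `|x| < N.+1%:R]%R : set (borel 'rV[R]_n)).
  by apply: open_borel; exact: open_norm_lt.
have ig : lam.-integrable [set: borel 'rV[R]_n] (EFin \o g).
  apply: (@integrable_lebesgue_rV n lam _ C N.+1 lamP).
  - by apply: measurable_funM => //; exact: measurable_indic.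
  - move=> x; rewrite /g normrM (ger0_norm C0) -[leRHS]mulr1 ler_wpM2l// indicE.
    by case: (_ \in _); rewrite /= ?normr1 ?normr0.
  - by move=> x Nx; rewrite /g indicE memNset ?mulr0//= ltNge Nx.
have : \int[lam]_x (f_ j x)%:E @[j --> \oo] --> \int[lam]_x (partial k F x)%:E.
  apply: (@dominated_cvg _ _ _ lam _ _ (fun j x => (f_ j x)%:E) _ (EFin \o g)) => //.
  - by move=> j; exact/measurable_EFinP.
  - move=> x _; apply: cvg_EFin; first exact: nearW.
    have dF : derivable F x (basis_vec k) by have [_ /(_ k)[]] := F1 x I.
    have hP : (forall j, h j != 0%R) /\ h j @[j --> \oo] --> (0 : R)%R.
      by split => [j|]; [rewrite /h invr_eq0|exact: cvg_harmonic].
    have H := (cvgr_dnbhsP _ _ _).1 dF h hP.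
    rewrite (_ : _ \o _ = (fun j => (h j)^-1 *: ((F \o shift x) (h j *: basis_vec k) - F x))%R); first exact: H.
    by apply/funext => j; rewrite /= /f_ /h invrK [(_ + x)%R]addrC.
  - move=> j x _; rewrite /= lee_fin /g indicE.
    have [Nx|Nx] := leP N.+1%:R%R `|x|%R; first by rewrite f_0// normr0 mulr_ge0.
    by rewrite mem_set// mulr1.
rewrite (_ : (fun j => _) = cst 0); last first.
  apply/funext => j; rewrite /f_.
  transitivity (\int[lam]_x (j.+1%:R%:E * ((F (x + h j *: basis_vec k)%R)%:E - (F x)%:E))) => //.
  have iFh : lam.-integrable [set: borel 'rV[R]_n] (fun x => (F (x + h j *: basis_vec k)%R)%:E).
    apply: (@integrable_lebesgue_rV n lam _ C1 N.+1 lamP) => // x Nx.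
    have := f_0 j x Nx; rewrite /f_ (F0N x) ?subr0; last by rewrite (le_trans _ Nx)// ler_nat.
    by move/eqP; rewrite mulf_eq0 pnatr_eq0/= => /eqP.
  rewrite integralZl//; last exact: integrableB.
  rewrite integralB_EFin// (integral_shift (h j *: basis_vec k) lamP (f := EFin \o F)).
    by rewrite subee ?mule0//; exact: integrable_fin_num.
  exact/measurable_EFinP.
by move=> /cvg_lim <-//; rewrite lim_cst.
Unshelve. all: by end_near. Qed.

End LebesgueRVTheory.

Section ContinuousOps.
Context {R : realType} {T : topologicalType}.

Lemma continuous_sum_at (J : Type) (r : seq J) (F : J -> T -> R) x :
  (forall j, {for x, continuous (F j)}) -> {for x, continuous (fun y => \sum_(j <- r) F j y)}.
Proof.
move=> cF; elim: r => [|j r ih].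
  rewrite (_ : (fun y => _) = cst 0); first exact: cst_continuous.
  by apply/funext => y; rewrite big_nil.
rewrite (_ : (fun y => _) = F j + (fun y => \sum_(j <- r) F j y)).
  by apply: continuousD => //; exact: cF.
by apply/funext => y; rewrite big_cons.
Qed.

End ContinuousOps.

(** * Composition of $C^1$ maps, and the sign of a nonvanishing function *)

Section C1Comp.
Context {R : realType}.

Lemma jacobian_entry n m (T : 'rV[R]_n -> 'rV[R]_m) x k l :
  differentiable T x -> 'J T x k l = partial k (fun y => T y 0 l) x.
Proof.
move=> dT; have /matrixP/(_ 0 l) := derive_mx (diff_derivable (v := basis_vec k) dT).
by rewrite deriveE// mxE /jacobian mxE => ->.
Qed.

Lemma C1_on_map_differentiable n m (A : set 'rV[R]_n) (T : 'rV[R]_n -> 'rV[R]_m) x :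
  open A -> (forall l, C1_on A (fun y => T y 0 l)) -> A x -> differentiable T x.
Proof.
by move=> oA TA Ax; apply: differentiable_rV => l; exact: C1_on_differentiable (TA l) Ax.
Qed.

Lemma C1_on_comp n m (A : set 'rV[R]_n) (B : set 'rV[R]_m) (T : 'rV[R]_n -> 'rV[R]_m)
    (f : 'rV[R]_m -> R) : open A -> open B -> (forall x, A x -> B (T x)) ->
  (forall l, C1_on A (fun y => T y 0 l)) -> C1_on B f -> C1_on A (f \o T).
Proof.
move=> oA oB AB TA fB.
have dT x : A x -> differentiable T x by exact: C1_on_map_differentiable TA.
have df x : A x -> differentiable f (T x) by move=> /AB; exact: C1_on_differentiable fB.
have cT x : A x -> {for x, continuous T} by move=> /dT; exact: differentiable_continuous.
apply: (@C1_on_is_derive _ _ _ _ (fun k x => \sum_l partial k (fun y => T y 0 l) x * partial l f (T x))) => //.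
- move=> x Ax; apply: continuous_comp; first exact: cT.
  exact: C1_on_continuous fB (AB _ Ax).
- move=> x k Ax; have := partial_comp k (dT x Ax) (df x Ax).
  rewrite (eq_bigr (fun l => partial k (fun y => T y 0 l) x * partial l f (T x))).
    move=> <-; apply: derivableP; apply: diff_derivable.
    by apply: differentiable_comp; [exact: dT|exact: df].
  by move=> l _; rewrite jacobian_entry//; exact: dT.
- move=> x k Ax; apply: continuous_sum_at => l; apply: continuousM.
    exact: C1_on_partial_continuous (TA l) Ax.
  apply: continuous_comp; first exact: cT.
  exact: C1_on_partial_continuous fB (AB _ Ax).
Qed.

Lemma partial_near_cst n (f : 'rV[R]_n -> R) (c : R) x k :
  (\forall y \near x, f y = c) -> partial k f x = 0.
Proof.
move=> fc; rewrite /partial (_ : 0 = 'D_(basis_vec k) (cst c) x); last by rewrite derive_cst.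
exact: near_eq_derive.
Qed.

Lemma partialM n (A : set 'rV[R]_n) f g x k : C1_on A f -> C1_on A g -> A x ->
  partial k (fun y => f y * g y) x = f x * partial k g x + g x * partial k f x.
Proof.
move=> fA gA Ax; rewrite /partial -[fun y => _]/(f * g).
by rewrite deriveM//; [exact: C1_on_derivable fA Ax|exact: C1_on_derivable gA Ax].
Qed.

Lemma near_eq_partial n (f g : 'rV[R]_n -> R) x k :
  (\forall y \near x, f y = g y) -> partial k f x = partial k g x.
Proof. by move=> fg; exact: near_eq_derive. Qed.

Lemma near_sgr n (A : set 'rV[R]_n) f x : C1_on A f -> A x -> f x != 0 ->
  \forall y \near x, Num.sg (f y) = Num.sg (f x).
Proof.
move=> fA Ax fx0; have cf := C1_on_continuous fA Ax.
have [f0|f0|/eqP] := ltgtP (f x) 0; last by rewrite (negbTE fx0).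
  have : \forall y \near x, f y < 0 by apply: (cf [set r | r < 0]); exact: lt_nbhsl.
  by apply: filterS => y y0; rewrite !ltr0_sg.
have : \forall y \near x, 0 < f y by apply: (cf [set r | 0 < r]); exact: lt_nbhsr.
by apply: filterS => y y0; rewrite !gtr0_sg.
Qed.

(** A nonvanishing continuous function has locally constant sign. This is applied to the density of
    the volume form, which may be negative and, on a disconnected chart, of both signs. *)
Lemma C1_on_sgr n (A : set 'rV[R]_n) f : open A -> C1_on A f ->
  (forall x, A x -> f x != 0) -> C1_on A (fun x => Num.sg (f x)).
Proof.
move=> oA fA f0; apply: (@C1_on_is_derive _ _ _ _ (fun _ _ => 0)) => //.
- move=> x Ax; have H := near_sgr fA Ax (f0 x Ax).
  have cs : {for x, continuous (cst (Num.sg (f x)) : 'rV[R]_n -> R)} by exact: cst_continuous.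
  rewrite /prop_for /continuous_at; apply: cvg_trans cs.
  by apply: (@near_eq_cvg _ _ (nbhs x)); apply: filterS H => y ->.
- move=> x k Ax; have H := near_sgr fA Ax (f0 x Ax).
  apply: (@near_eq_is_derive _ _ _ (cst (Num.sg (f x)))).
  by apply: filterS H => y ->.
- by move=> x k Ax; exact: cst_continuous.
Qed.

End C1Comp.

(** * Chart changes, gradients and the metric pairing *)

Section Charts.
Context {R : realType} {n : nat} {M : riemannian_manifold R n}.
Implicit Types (i j : chart_index M) (p : M) (f g : M -> R).

Lemma open_cimg i : open (cimg (atlas i)).
Proof. exact: cimg_open. Qed.

Lemma open_cdom i : open (cdom (atlas i)).
Proof. exact: cdom_open. Qed.

Lemma cimg_cmap i p : cdom (atlas i) p -> cimg (atlas i) (cmap (atlas i) p).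
Proof. by move=> ip; exists p. Qed.

Lemma cdom_cinv i x : cimg (atlas i) x -> cdom (atlas i) (cinv (atlas i) x).
Proof. by move=> [p ip <-]; rewrite cmapK. Qed.

Lemma cinvK i x : cimg (atlas i) x -> cmap (atlas i) (cinv (atlas i) x) = x.
Proof. by move=> [p ip <-]; rewrite cmapK. Qed.

Lemma chart_atP p : cdom (atlas (chart_at p)) p.
Proof. by rewrite /chart_at; case: cid. Qed.

Lemma continuous_chart (U : topologicalType) (f : M -> U) i p : cdom (atlas i) p ->
  {for cmap (atlas i) p, continuous (f \o cinv (atlas i))} -> {for p, continuous f}.
Proof.
move=> ip cf; have fp : (f \o cinv (atlas i)) (cmap (atlas i) p) = f p by rewrite /= cmapK.
rewrite /prop_for /continuous_at -fp.
apply: cvg_trans (continuous_comp (cmap_continuous ip) cf).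
apply: (@near_eq_cvg _ _ (nbhs p)).
apply: filterS (open_nbhs_nbhs (conj (@open_cdom i) ip)) => q iq /=.
by rewrite cmapK.
Qed.

Lemma open_cinv_preimage i (V : set M) : open V ->
  open (cimg (atlas i) `&` cinv (atlas i) @^-1` V).
Proof.
move=> oV; apply: open_setI_preimage => //; first exact: open_cimg.
exact: cinv_continuous.
Qed.

Definition overlap i j := cimg (atlas i) `&` cinv (atlas i) @^-1` cdom (atlas j).

Lemma open_overlap i j : open (overlap i j).
Proof. by apply: open_cinv_preimage; exact: cdom_open. Qed.

Lemma cmap_overlap i j p : cdom (atlas i) p -> cdom (atlas j) p ->
  overlap i j (cmap (atlas i) p).
Proof. by move=> ip jp; split; [exact: cimg_cmap|rewrite /= cmapK]. Qed.

Lemma C1_on_transition i j k :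
  C1_on (overlap i j) (fun x => transition (atlas i) (atlas j) x 0 k).
Proof.
apply: (sub_C1_on _ (smooth_on_C1 (@atlas_smooth _ _ M i j k))) => x [ix jx].
by exists (cinv (atlas i) x); [split => //; exact: cdom_cinv|exact: cinvK].
Qed.

Lemma transition_differentiable i j x : overlap i j x ->
  differentiable (transition (atlas i) (atlas j)) x.
Proof.
move=> ox; apply: (C1_on_map_differentiable (@open_overlap i j) _ ox) => l.
exact: C1_on_transition.
Qed.

Lemma cimg_transition i j x : overlap i j x ->
  cimg (atlas j) (transition (atlas i) (atlas j) x).
Proof. by move=> [ix jx]; exact: cimg_cmap. Qed.

Lemma cinv_transition i j x : overlap i j x ->
  cinv (atlas j) (transition (atlas i) (atlas j) x) = cinv (atlas i) x.
Proof. by move=> [ix jx]; rewrite /transition cmapK. Qed.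

Definition C1_fun f := forall i, C1_on (cimg (atlas i)) (f \o cinv (atlas i)).

Lemma smooth_fun_C1 f : smooth_fun f -> C1_fun f.
Proof. by move=> fM i; exact: smooth_on_C1. Qed.

Lemma C1_fun_continuous f : C1_fun f -> continuous f.
Proof.
move=> fM p; apply: (continuous_chart (chart_atP p)).
exact: C1_on_continuous (fM _) (cimg_cmap (chart_atP p)).
Qed.

Lemma C1_fun_cst (c : R) : C1_fun (cst c).
Proof. by move=> i; apply: C1_on_cst; exact: open_cimg. Qed.

Lemma C1_funD f g : C1_fun f -> C1_fun g -> C1_fun (fun p => f p + g p).
Proof. by move=> fM gM i; apply: C1_onD (fM i) (gM i); exact: open_cimg. Qed.

Lemma C1_funM f g : C1_fun f -> C1_fun g -> C1_fun (fun p => f p * g p).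
Proof. by move=> fM gM i; apply: C1_onM (fM i) (gM i); exact: open_cimg. Qed.

Lemma C1_funN f : C1_fun f -> C1_fun (fun p => - f p).
Proof. by move=> fM i; apply: C1_onN (fM i); exact: open_cimg. Qed.

(** The components of the covector $df$, separated from the inverse Gram matrix because the two
    transform differently under a change of chart. *)
Definition dchart i f p : 'rV[R]_n :=
  \row_k partial k (f \o cinv (atlas i)) (cmap (atlas i) p).

Lemma gradE i f p : grad f i p = dchart i f p *m invmx (gram i (cmap (atlas i) p)).
Proof. by []. Qed.

(** The chain rule, since near [p] the expression of [f] in chart [i] is its expression in chart [j]
    composed with the transition map. *)
Lemma dchart_transition i j f p : C1_fun f -> cdom (atlas i) p -> cdom (atlas j) p ->
  dchart i f p = dchart j f p *m ('J (transition (atlas i) (atlas j)) (cmap (atlas i) p))^T.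
Proof.
move=> fM ip jp; have ijp := cmap_overlap ip jp.
apply/rowP => k; rewrite !mxE.
rewrite (@near_eq_partial _ _ _ ((f \o cinv (atlas j)) \o transition (atlas i) (atlas j))); last first.
  have := open_nbhs_nbhs (conj (@open_overlap i j) ijp); apply: filterS => y ijy /=.
  by rewrite cinv_transition.
rewrite partial_comp.
- by apply: eq_bigr => l _; rewrite !mxE /transition cmapK// mulrC.
- exact: transition_differentiable.
- exact: (C1_on_differentiable (@open_cimg j) (fM j) (cimg_transition ijp)).
Qed.

Lemma gram_unit i x : cimg (atlas i) x -> gram i x \in unitmx.
Proof.
move=> ix; rewrite -row_free_unit -kermx_eq0; apply/rowV0P => v /sub_kermxP vG.
apply/eqP; apply: contraT => v0; have := gram_pos ix v0.
by rewrite vG mul0mx mxE ltxx.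
Qed.

(** The pairing equals $df(\nabla g)$, because the Gram matrix cancels the inverse in the gradient.
    It is then moved from the chart selected by [chart_at] to an arbitrary one, which allows
    computation in a fixed chart near a point. *)
Lemma metric_gradE i f g p : C1_fun f -> C1_fun g -> cdom (atlas i) p ->
  metric (grad f) (grad g) p =
  \sum_k partial k (f \o cinv (atlas i)) (cmap (atlas i) p) * grad g i p 0 k.
Proof.
move=> fM gM ip; rewrite /metric; set j := chart_at p; have jp : cdom (atlas j) p := chart_atP p.
have key l : cdom (atlas l) p ->
    grad f l p *m gram l (cmap (atlas l) p) *m (grad g l p)^T =
    dchart l f p *m (grad g l p)^T.
  by move=> lp; rewrite gradE mulmxKV//; apply: gram_unit; exact: cimg_cmap.
rewrite key//.
suff -> : dchart j f p *m (grad g j p)^T = dchart i f p *m (grad g i p)^T.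
  by rewrite mxE; apply: eq_bigr => k _; rewrite !mxE.
set J := 'J (transition (atlas i) (atlas j)) (cmap (atlas i) p).
have GE : gram i (cmap (atlas i) p) = J *m gram j (cmap (atlas j) p) *m J^T.
  exact: gram_compat.
have uGi := gram_unit (cimg_cmap ip). have uGj := gram_unit (cimg_cmap jp).
have uJ : J \in unitmx.
  by move: uGi; rewrite GE !unitmx_mul => /andP[/andP[]].
rewrite !gradE !trmx_mul (dchart_transition fM ip jp) (dchart_transition gM ip jp) -/J.
rewrite trmx_mul trmxK !mulmxA; congr (_ *m _).
rewrite -!mulmxA; congr (_ *m _); rewrite !trmx_inv !gram_sym ?mulmxA//; try exact: cimg_cmap.
(* With the covectors stripped off, what remains is $G_j^{-1}=J^TG_i^{-1}J$, the inverted form of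
   [GE]. *)
set Gi := gram i _ in GE uGi *; set Gj := gram j _ in GE uGj *.
have GJ : Gj *m J^T = invmx J *m Gi by rewrite GE !mulmxA mulVmx// mul1mx.
by apply: (can_inj (mulKmx uGj)); rewrite mulmxV// !mulmxA GJ mulmxK// mulVmx.
Qed.

Lemma metric_gradM f g h p : C1_fun f -> C1_fun g -> C1_fun h ->
  metric (grad (fun q => f q * g q)) (grad h) p =
  f p * metric (grad g) (grad h) p + g p * metric (grad f) (grad h) p.
Proof.
move=> fM gM hM; have ip := chart_atP p.
rewrite (metric_gradE (C1_funM fM gM) hM ip) (metric_gradE fM hM ip) (metric_gradE gM hM ip).
rewrite !mulr_sumr -big_split/=; apply: eq_bigr => k _.
rewrite (partialM k (fM _) (gM _) (cimg_cmap ip)) mulrDl !mulrA.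
by rewrite /= cmapK.
Qed.

Lemma metric_gradD f g h p : C1_fun f -> C1_fun g -> C1_fun h ->
  metric (grad (fun q => f q + g q)) (grad h) p =
  metric (grad f) (grad h) p + metric (grad g) (grad h) p.
Proof.
move=> fM gM hM; have ip := chart_atP p.
rewrite (metric_gradE (C1_funD fM gM) hM ip) (metric_gradE fM hM ip) (metric_gradE gM hM ip).
rewrite -big_split/=; apply: eq_bigr => k _; rewrite -mulrDl; congr (_ * _).
rewrite /partial -[_ \o _]/((f \o cinv _) + (g \o cinv _)) deriveD//.
  exact: C1_on_derivable (fM _) (cimg_cmap ip).
exact: C1_on_derivable (gM _) (cimg_cmap ip).
Qed.

Lemma metric_grad_near_cst f h p (c : R) : C1_fun f -> C1_fun h ->
  (\forall q \near p, f q = c) -> metric (grad f) (grad h) p = 0.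
Proof.
move=> fM hM fc; have ip := chart_atP p; rewrite (metric_gradE fM hM ip) big1// => k _.
rewrite (@partial_near_cst _ _ _ c) ?mul0r//.
have fc' : nbhs (cinv (atlas (chart_at p)) (cmap (atlas (chart_at p)) p)) [set q | f q = c].
  by rewrite cmapK.
have cc : {for cmap (atlas (chart_at p)) p, continuous (cinv (atlas (chart_at p)))}.
  exact: cinv_continuous (cimg_cmap ip).
exact: (cc _ fc').
Qed.

Lemma C1_on_grad h i k : smooth_fun h ->
  C1_on (cimg (atlas i)) (fun x => grad h i (cinv (atlas i) x) 0 k).
Proof.
move=> hM; have oV := @open_cimg i.
apply: (@eq_C1_on _ _ _ (fun x => \sum_l partial l (h \o cinv (atlas i)) x * invmx (gram i x) l k)) => //.
  by move=> x ix; rewrite !mxE; apply: eq_bigr => l _; rewrite !mxE cinvK.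
apply: C1_on_sum => // l; apply: C1_onM => //.
  by apply: smooth_on_C1; apply: smooth_on_partial; exact: hM.
apply: C1_on_invmx => // [a b|x]; last exact: gram_unit.
by apply: smooth_on_C1; exact: gram_smooth.
Qed.

(** The definition of [metric] selects a chart separately at every point, so continuity is visible
    only after [metric_gradE] has put a whole neighbourhood into one chart. *)
Lemma metric_grad_continuous f h : C1_fun f -> smooth_fun h ->
  continuous (metric (grad f) (grad h)).
Proof.
move=> fM hM p; have ip := chart_atP p; set i := chart_at p in ip *.
have ix := cimg_cmap ip; have hC := smooth_fun_C1 hM.
apply: (continuous_chart ip).
have : {for cmap (atlas i) p, continuous (fun x =>
    \sum_k partial k (f \o cinv (atlas i)) x * grad h i (cinv (atlas i) x) 0 k)}.
  apply: continuous_sum_at => k; apply: continuousM.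
    exact: C1_on_partial_continuous (fM i) ix.
  exact: C1_on_continuous (@C1_on_grad h i k hM) ix.
move=> cs; rewrite /prop_for /continuous_at.
rewrite [X in _ --> X](_ : _ = \sum_k partial k (f \o cinv (atlas i)) (cmap (atlas i) p) * grad h i p 0 k); last first.
  by rewrite /= cmapK// (metric_gradE fM hC ip).
have := cs; rewrite /prop_for /continuous_at cmapK//; apply: cvg_trans.
apply: (@near_eq_cvg _ _ (nbhs (cmap (atlas i) p))).
apply: filterS (open_nbhs_nbhs (conj (@open_cimg i) ix)) => x Vx /=.
by rewrite (metric_gradE fM hC (cdom_cinv Vx)) cinvK.
Qed.

End Charts.

(** * Integrals over the manifold computed in a chart *)

Section ManifoldIntegral.
Context {R : realType} {n : nat} {M : riemannian_manifold R n}.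
Variables (w : volume_form M) (mu : {measure set (borel M) -> \bar R}).
Hypothesis Hmu : volume_measure w mu.
Variable lam : {measure set (borel 'rV[R]_n) -> \bar R}.
Hypothesis lamP : is_lebesgue_rV lam.
Implicit Types (i j : chart_index M) (p : M).

Definition chart_density i : 'rV[R]_n -> R :=
  (fun x => `|w i x|) \_ (cimg (atlas i)).

(** Outside the image of the chart the value is the default point of [M], possibly inside the chart
    domain; this is harmless because [chart_density] vanishes there. *)
Definition total_cinv i : 'rV[R]_n -> M := cinv (atlas i) \_ (cimg (atlas i)).

Lemma vdens_C1 i : C1_on (cimg (atlas i)) (w i).
Proof. by apply: smooth_on_C1; exact: vdens_smooth. Qed.

Lemma measurable_cimg i : measurable (cimg (atlas i) : set (borel 'rV[R]_n)).
Proof. by apply: open_borel; exact: open_cimg. Qed.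

Lemma measurable_chart_density i :
  measurable_fun [set: borel 'rV[R]_n] (chart_density i).
Proof.
have H : measurable_fun (cimg (atlas i) : set (borel 'rV[R]_n)) (fun x => `|w i x|).
  apply: continuous_on_measurable; first exact: open_cimg.
  move=> x ix; apply: continuous_comp; last exact: norm_continuous.
  exact: C1_on_continuous (@vdens_C1 i) ix.
exact/(measurable_restrictT _ (@measurable_cimg i)).
Qed.

Lemma measurable_total_cinv i :
  measurable_fun [set: borel 'rV[R]_n] (total_cinv i : _ -> borel M).
Proof.
have H : measurable_fun (cimg (atlas i) : set (borel 'rV[R]_n))
    (cinv (atlas i) : borel 'rV[R]_n -> borel M).
  apply: continuous_on_borel; first exact: open_cimg.
  by move=> x ix; exact: cinv_continuous.
exact/(measurable_restrictT _ (@measurable_cimg i)).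
Qed.

Lemma chart_density_ge0 i x : 0 <= chart_density i x.
Proof. by rewrite /chart_density patchE; case: ifP. Qed.

Lemma measurable_cdom i : measurable (cdom (atlas i) : set (borel M)).
Proof. by apply: open_borel; exact: open_cdom. Qed.

Lemma volume_measure_density i (A : set (borel M)) : measurable A ->
  A `<=` cdom (atlas i) ->
  mu A = (\int[lam]_x (\1_A (total_cinv i x) * chart_density i x)%:E)%E.
Proof.
move=> mA Ai; rewrite (Hmu mA Ai).
rewrite (_ : (fun x => _) = (fun x => (\1_A (total_cinv i x) * chart_density i x)%:E)).
  rewrite lamP.2//.
    apply/measurable_EFinP; apply: measurable_funM; last exact: measurable_chart_density.
    rewrite (_ : (fun x => _) = \1_(total_cinv i @^-1` A)); last by [].
    apply: measurable_indic; rewrite -[X in measurable X]setTI.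
    by apply: (@measurable_total_cinv i).
  by move=> x; rewrite lee_fin mulr_ge0// chart_density_ge0.
apply/funext => x; congr EFin; rewrite /total_cinv /chart_density !patchE.
case: ifPn => [/set_mem ix|nix]; last first.
  rewrite mulr0 indicE memNset ?mul0r// => -[p Ap px].
  by move/negP: nix; apply; apply/mem_set; exists p => //; exact: Ai.
congr (_ * _); rewrite !indicE; congr (_ %:R); congr nat_of_bool.
apply/idP/idP => /set_mem H; apply/mem_set.
  by case: H => p Ap px; rewrite -px cmapK//; exact: Ai.
by exists (cinv (atlas i) x) => //; exact: cinvK.
Qed.

Lemma ge0_integral_chart i (g : M -> \bar R) :
  measurable_fun [set: borel M] g -> (forall p, (0 <= g p)%E) ->
  (forall p, ~ cdom (atlas i) p -> g p = 0%E) ->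
  (\int[mu]_p g p = \int[lam]_x (g (total_cinv i x) * (chart_density i x)%:E))%E.
Proof.
move=> mg g0 gi; have mi := @measurable_cdom i.
rewrite (_ : (\int[mu]_p g p = \int[mu]_(p in cdom (atlas i)) g p)%E).
  apply: (ge0_integral_image_density mi (@measurable_total_cinv i) (@measurable_chart_density i)).
  - exact: chart_density_ge0.
  - move=> x; rewrite /total_cinv /chart_density !patchE; case: ifP => // /set_mem ix H; exfalso.
    by apply: H; exact: cdom_cinv.
  - by move=> A mA Ai; exact: volume_measure_density.
  - exact: measurable_funTS.
  - by [].
rewrite [RHS]integral_mkcond; apply: eq_integral => p _; rewrite patchE.
by case: ifPn => //; rewrite notin_setE => /gi.
Qed.

Lemma integral_chart i (g : M -> R) : measurable_fun [set: borel M] g ->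
  (forall p, ~ cdom (atlas i) p -> g p = 0) ->
  (\int[mu]_p (g p)%:E = \int[lam]_x (g (total_cinv i x) * chart_density i x)%:E)%E.
Proof.
move=> mg gi; rewrite [LHS]integralE [RHS]integralE.
have ? : measurable_fun [set: borel M] (EFin \o g) by exact/measurable_EFinP.
congr (_ - _)%E.
- rewrite (@ge0_integral_chart i); first last.
  + by move=> p /gi gp; rewrite funeposE gp maxxx.
  + by move=> p; exact: funepos_ge0.
  + exact: measurable_funepos.
  apply: eq_integral => x _; rewrite !funeposE -!EFin_max -EFinM; congr EFin.
  by rewrite maxr_pMl ?chart_density_ge0// mul0r.
- rewrite (@ge0_integral_chart i); first last.
  + by move=> p /gi gp; rewrite funenegE gp oppe0 maxxx.
  + by move=> p; exact: funeneg_ge0.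
  + exact: measurable_funeneg.
  apply: eq_integral => x _; rewrite !funenegE -!EFinN -!EFin_max -EFinM; congr EFin.
  by rewrite maxr_pMl ?chart_density_ge0// mul0r mulNr.
Qed.

End ManifoldIntegral.

(** * Green's formula for functions supported in one chart *)

Section Green.
Context {R : realType} {n : nat} {M : riemannian_manifold R n}.
Variables (w : volume_form M) (mu : {measure set (borel M) -> \bar R}).
Hypothesis Hmu : volume_measure w mu.
Hypothesis mu_fin : (mu [set: borel M] < +oo)%E.
Variables (r h D : M -> R).
Hypotheses (r_smooth : smooth_fun r) (h_smooth : smooth_fun h).
Hypothesis DE : forall i p, cdom (atlas i) p -> D p = div w (scale_field r (grad h)) i p.
Implicit Types (i j : chart_index M) (p : M) (f : M -> R).

(** The vector density $wX$ for $X=r\nabla h$: up to sign, its components are the coefficients of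
    the form $i_Xw$. *)
Definition flux_comp i (k : 'I_n) (x : 'rV[R]_n) : R :=
  w i x * (r (cinv (atlas i) x) * grad h i (cinv (atlas i) x) 0 k).

Lemma flux_comp_C1 i k : C1_on (cimg (atlas i)) (flux_comp i k).
Proof.
have oi := @open_cimg _ _ M i.
apply: C1_onM => //; first exact: vdens_C1.
by apply: C1_onM => //; [apply: smooth_on_C1; exact: r_smooth|exact: C1_on_grad].
Qed.

Lemma D_chart i x : cimg (atlas i) x ->
  w i x * D (cinv (atlas i) x) = \sum_k partial k (flux_comp i k) x.
Proof.
move=> ix; rewrite (DE (cdom_cinv ix)) /div cinvK// mulrA mulfV ?mul1r; last exact: vdens_neq0.
apply: eq_bigr => k _; congr (partial k _ x); apply/funext => y.
by rewrite /flux_comp /scale_field mxE.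
Qed.

Lemma D_continuous : continuous D.
Proof.
move=> p; have ip := chart_atP p; set i := chart_at p in ip *.
have ix := cimg_cmap ip; have oi := @open_cimg _ _ M i.
apply: (continuous_chart ip).
have : {for cmap (atlas i) p, continuous (fun x => (w i x)^-1 * \sum_k partial k (flux_comp i k) x)}.
  apply: continuousM.
    apply: continuousV; first exact: vdens_neq0.
    exact: C1_on_continuous (@vdens_C1 _ _ _ w i) ix.
  by apply: continuous_sum_at => k; exact: C1_on_partial_continuous (@flux_comp_C1 i k) ix.
have E x : cimg (atlas i) x ->
    (w i x)^-1 * (\sum_k partial k (flux_comp i k) x) = D (cinv (atlas i) x).
  by move=> Vx; rewrite -D_chart// mulKf//; exact: vdens_neq0.
rewrite /prop_for /continuous_at E// => cs.
rewrite [X in _ --> X]/=; apply: cvg_trans cs.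
apply: (@near_eq_cvg _ _ (nbhs (cmap (atlas i) p))).
by apply: filterS (open_nbhs_nbhs (conj oi ix)) => x Vx /=; rewrite E.
Qed.

(** By the Leibniz rule this is the divergence of $f\,r\nabla h$, so Green's formula says that its
    integral vanishes. *)
Definition green_integrand f p : R := f p * D p + metric (grad f) (grad h) p * r p.

Lemma green_integrand_continuous f : C1_fun f -> continuous (green_integrand f).
Proof.
move=> fM p.
suff : {for p, continuous ((f * D) + (metric (grad f) (grad h) * r))} by [].
apply: continuousD; apply: continuousM.
- exact: C1_fun_continuous.
- exact: D_continuous.
- exact: metric_grad_continuous.
- exact: (C1_fun_continuous (smooth_fun_C1 r_smooth)).
Qed.

Lemma green_integrand_support f (K : set M) : C1_fun f -> compact K ->
  (forall p, ~ K p -> f p = 0) -> forall p, ~ K p -> green_integrand f p = 0.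
Proof.
move=> fM cK f0 p Kp; rewrite /green_integrand f0// mul0r add0r.
have hC := smooth_fun_C1 h_smooth.
rewrite (metric_grad_near_cst (c := 0) fM hC) ?mul0r//.
have oK : open (~` K).
  by apply: closed_openC; apply: compact_closed => //; exact: carrier_hausdorff.
by apply: filterS (open_nbhs_nbhs (conj oK Kp)) => q; exact: f0.
Qed.

Lemma continuous_borel_fun f : continuous f -> measurable_fun [set: borel M] f.
Proof. by move=> cf; apply: continuous_on_measurable; [exact: openT|move=> x _; exact: cf]. Qed.

Lemma compact_support_integrable f (K : set M) : continuous f -> compact K ->
  (forall p, ~ K p -> f p = 0) -> mu.-integrable [set: borel M] (EFin \o f).
Proof.
move=> cf cK f0; have [C fC] := continuous_compact_support_bounded cK cf f0.
apply: (@integrable_bounded_support _ _ _ _ (K : set (borel M)) _ C) => //.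
- by apply: closed_borel; apply: compact_closed => //; exact: carrier_hausdorff.
- apply: le_lt_trans mu_fin; apply: le_measure; rewrite ?inE//.
  by apply: closed_borel; apply: compact_closed => //; exact: carrier_hausdorff.
- exact: continuous_borel_fun.
Qed.

(** In the chart, the integrand times $|w|$ is the Euclidean divergence of $\mathrm{sg}(w)\,f$ times
    the vector density [flux_comp]. Extended by zero, this field is $C^1$ with bounded support on
    $\mathbb{R}^n$, and each partial derivative has integral 0. *)
Lemma green_local i f (C : set 'rV[R]_n) : C1_fun f -> compact C -> C `<=` cimg (atlas i) ->
  (forall p, ~ (cinv (atlas i) @` C) p -> f p = 0) ->
  \int[mu]_p green_integrand f p = 0.
Proof.
move=> fM cC Ci f0; have [lam lamP] := lebesgue_integral_rV_measure (R := R) n.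
have oi := @open_cimg _ _ M i.
have hC := smooth_fun_C1 h_smooth.
have cK : compact (cinv (atlas i) @` C).
  apply: continuous_compact => //; apply: continuous_in_subspaceT => x /set_mem Cx.
  by apply: cinv_continuous; exact: Ci.
have g0 := green_integrand_support fM cK f0.
have clC : closed C by apply: compact_closed => //; exact: norm_hausdorff.
have oC : open (~` C) := closed_openC clC.
(* The sign of w is locally constant, so |w| = sg(w) w may be moved inside the
   partial derivatives. *)
pose F k x := if x \in cimg (atlas i)
  then Num.sg (w i x) * (f (cinv (atlas i) x) * flux_comp i k x) else 0.
have wC := @vdens_C1 _ _ _ w i.
have w0 := @vdens_neq0 _ _ _ w i.
have fxC k : C1_on (cimg (atlas i)) (fun x => f (cinv (atlas i) x) * flux_comp i k x).
  by apply: C1_onM => //; exact: flux_comp_C1.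
have F_C k x : ~ C x -> F k x = 0.
  move=> Cx; rewrite /F; case: ifPn => // /set_mem ix.
  rewrite f0 ?mul0r ?mulr0// => -[y Cy yx]; apply: Cx.
  by rewrite -(cinvK ix) -yx cinvK//; exact: Ci.
(* The image of the chart and the complement of [C] are open and cover the space; on the second one
   [F k] is zero. *)
have F1 k : C1_on setT (F k).
  have H1 : C1_on (cimg (atlas i)) (F k).
    apply: (@eq_C1_on _ _ _ (fun x => Num.sg (w i x) * (f (cinv (atlas i) x) * flux_comp i k x))) => //.
      by move=> x ix; rewrite /F mem_set.
    by apply: C1_onM => //; exact: C1_on_sgr.
  have H2 : C1_on (~` C) (F k).
    apply: (@eq_C1_on _ _ _ (fun=> 0)) => //; first by move=> x Cx; rewrite F_C.
    exact: C1_on_cst.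
  by move=> x _; have [/Ci ix|Cx] := pselect (C x); [exact: H1|exact: H2].
have [b bC] : exists b : R, forall x, C x -> `|x| < b.
  have [B [_ HB]] := compact_bounded cC; exists (`|B| + 2) => x Cx.
  have : `|x| <= `|B| + 1 by apply: HB => //; rewrite (le_lt_trans (ler_norm _))// ltrDl.
  by move/le_lt_trans; apply; rewrite ltrD2l ltr1n.
have Fb k x : b <= `|x| -> F k x = 0.
  by move=> bx; apply: F_C => /bC; rewrite ltNge bx.
have FI k := integral_partial_eq0 k lamP (F1 k) (Fb k).
rewrite /Rintegral (integral_chart Hmu lamP (i := i)); first last.
- move=> p ip; apply: g0 => -[x Cx xp]; apply: ip; rewrite -xp.
  by apply: cdom_cinv; exact: Ci.
- by apply: continuous_borel_fun; exact: green_integrand_continuous.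
rewrite (_ : (\int[lam]_x _)%E = (\int[lam]_x (\sum_k (partial k (F k) x)%:E)%E)%E).
  rewrite integral_sum//; last by move=> k; exact: (FI k).1.
  by rewrite big1// => k _; exact: (FI k).2.
apply: eq_integral => x _; rewrite sumEFin; congr EFin.
rewrite /total_cinv /chart_density !patchE; case: ifPn => [/set_mem ix|nix]; last first.
  rewrite mulr0 big1// => k _; apply: (partial_near_cst (c := 0)).
  have Cx : ~ C x by move=> /Ci /mem_set; exact/negP.
  by apply: filterS (open_nbhs_nbhs (conj oC Cx)) => y; exact: F_C.
have FE k : partial k (F k) x = Num.sg (w i x) * (f (cinv (atlas i) x) * partial k (flux_comp i k) x
    + flux_comp i k x * partial k (f \o cinv (atlas i)) x).
  have sgC : C1_on (cimg (atlas i)) (fun x => Num.sg (w i x)) by exact: C1_on_sgr.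
  have sg0 : partial k (fun x => Num.sg (w i x)) x = 0.
    exact: (partial_near_cst _ (near_sgr wC ix (w0 _ ix))).
  rewrite (@near_eq_partial _ _ _ (fun x => Num.sg (w i x) * (f (cinv (atlas i) x) * flux_comp i k x))).
    rewrite (partialM k sgC (fxC k) ix) (partialM k (fM i) (@flux_comp_C1 i k) ix).
    by rewrite sg0 mulr0 addr0.
  by apply: filterS (open_nbhs_nbhs (conj oi ix)) => y Vy; rewrite /F mem_set.
rewrite (eq_bigr _ (fun k _ => FE k)) -mulr_sumr big_split/= -!mulr_sumr -D_chart//.
rewrite /green_integrand (metric_gradE fM hC (cdom_cinv ix)) cinvK//.
rewrite normrEsg.
have -> : \sum_k flux_comp i k x * partial k (f \o cinv (atlas i)) x =
    w i x * ((\sum_k partial k (f \o cinv (atlas i)) x * grad h i (cinv (atlas i) x) 0 k) * r (cinv (atlas i) x)).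
  by rewrite mulr_suml mulr_sumr; apply: eq_bigr => k _; rewrite /flux_comp; ring.
by ring.
Qed.

End Green.

(** * Bump functions on the manifold *)

Section Bump.
Context {R : realType} {n : nat} {M : riemannian_manifold R n}.

(** A plateau function read in a chart around [p0] and extended by zero. Being equal to 1 on an open
    set is what turns a finite cover into a vanishing product of factors $1-b$. *)
Lemma bump_exists (p0 : M) : exists b : M -> R, C1_fun b /\
  (exists i (C : set 'rV[R]_n), [/\ compact C, C `<=` cimg (atlas i) &
    forall q, ~ (cinv (atlas i) @` C) q -> b q = 0]) /\
  exists O : set M, [/\ open O, O p0 & forall q, O q -> b q = 1].
Proof.
have ip := chart_atP p0; set i := chart_at p0 in ip *.
set a := cmap (atlas i) p0; have oi := @open_cimg _ _ M i.
have /nbhs_ballP[e /= e0 eV] : nbhs a (cimg (atlas i)).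
  by apply: open_nbhs_nbhs; split => //; exact: cimg_cmap.
(* With this scale the support lies in $|x-a|\le e/\sqrt2$, and $e/\sqrt2<\frac34e<e$ keeps it
   inside the ball contained in the image of the chart. *)
pose rr := 4 / e ^+ 2; have rr0 : 0 < rr by rewrite divr_gt0// exprn_gt0.
pose C := [set x | rr * sqdist a x <= 2].
have cs : continuous (fun x => rr * sqdist a x).
  move=> x; suff : {for x, continuous (cst rr \* sqdist a)} by [].
  by apply: continuousM; [exact: cst_continuous|exact: sqdist_continuous].
have Ca x : C x -> `|x - a| <= 3 / 4 * e.
  move=> Cx; apply: norm_rV_le => [|k]; first by rewrite mulr_ge0// ltW.
  rewrite !mxE -(@ler_pXn2r _ 2) ?nnegrE// ?mulr_ge0// ?(ltW e0)//.
  rewrite real_normK ?num_real//; apply: le_trans (sqr_coord_le_sqdist a x k) _.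
  move: Cx; rewrite /C /rr /= mulrAC ler_pdivrMr ?exprn_gt0// => Cx.
  have : 0 <= e ^+ 2 by rewrite sqr_ge0.
  by rewrite exprMn; lra.
have CV : C `<=` cimg (atlas i).
  move=> x /Ca xa; apply: eV; rewrite -ball_normE/= distrC; apply: le_lt_trans xa _.
  by move: e0; lra.
have clC : closed C.
  by apply: (@closed_comp _ _ (fun x => rr * sqdist a x) [set r | r <= 2]);
    [move=> x _; exact: cs|exact: closed_le].
have cC : compact C.
  apply: (subclosed_compact clC (@compact_norm_le R n (`|a| + 3 / 4 * e))) => x /Ca xa /=.
  by rewrite -[x](subrK a) addrC; apply: le_trans (ler_normD _ _) _; rewrite lerD2l.
pose b q := if q \in cdom (atlas i) then plateau a rr (cmap (atlas i) q) else 0.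
have b0 q : ~ (cinv (atlas i) @` C) q -> b q = 0.
  move=> Kq; rewrite /b; case: ifPn => // /set_mem iq; apply: smoothstep0.
  rewrite subr_le0 leNgt; apply/negP => /ltW Cq; apply: Kq.
  by exists (cmap (atlas i) q) => //; rewrite cmapK.
have clK : closed (cinv (atlas i) @` C).
  apply: compact_closed; first exact: carrier_hausdorff.
  apply: continuous_compact => //; apply: continuous_in_subspaceT => x /set_mem Cx.
  by apply: cinv_continuous; exact: CV.
exists b; split; [|split].
(* Seen from chart [j], the overlap with [i] and the complement of the support form an open cover.
   On the first set the bump is a plateau composed with a transition map, on the second it is 0. *)
- move=> j; have oj := @open_cimg _ _ M j.
  have H1 : C1_on (overlap j i) (b \o cinv (atlas j)).
    apply: (@eq_C1_on _ _ _ (plateau a rr \o transition (atlas j) (atlas i))).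
    + exact: open_overlap.
    + by move=> x [jx ix]; rewrite /= /b mem_set.
    + apply: (@C1_on_comp _ _ _ _ setT) => //.
      * exact: open_overlap.
      * exact: openT.
      * by move=> l; exact: C1_on_transition.
      * by apply: C1_on_plateau; exact: openT.
  have H2 : C1_on (cimg (atlas j) `&` cinv (atlas j) @^-1` (~` (cinv (atlas i) @` C))) (b \o cinv (atlas j)).
    have oW : open (cimg (atlas j) `&` cinv (atlas j) @^-1` (~` (cinv (atlas i) @` C))).
      by apply: open_cinv_preimage; exact: closed_openC.
    apply: (eq_C1_on oW _ (C1_on_cst (0 : R) oW)) => x [jx Kx].
    by rewrite /= b0.
  move=> y jy; have [iy|iy] := pselect (cdom (atlas i) (cinv (atlas j) y)).
    by apply: H1; split.
  apply: H2; split => //= -[x Cx xy]; apply: iy; rewrite -xy.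
  by apply: cdom_cinv; exact: CV.
- by exists i, C.
- exists (cdom (atlas i) `&` cmap (atlas i) @^-1` [set x | rr * sqdist a x < 1]); split.
  + apply: open_setI_preimage; first exact: cdom_open.
      by move=> x ix; exact: cmap_continuous.
    by apply: (@open_comp _ _ (fun x => rr * sqdist a x) [set r | r < 1]);
      [move=> x _; exact: cs|exact: open_lt].
  + by split => //=; rewrite sqdistxx mulr0 ltr01.
  + move=> q [iq /= qa]; rewrite /b mem_set//; apply: smoothstep1.
    by move: qa; lra.
Qed.

End Bump.

(** * Green's formula on the whole manifold *)

Section GreenGlobal.
Context {R : realType} {n : nat} {M : riemannian_manifold R n}.
Variables (w : volume_form M) (mu : {measure set (borel M) -> \bar R}).
Hypothesis Hmu : volume_measure w mu.
Hypothesis mu_fin : (mu [set: borel M] < +oo)%E.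
Variables (r h D : M -> R).
Hypotheses (r_smooth : smooth_fun r) (h_smooth : smooth_fun h).
Hypothesis DE : forall i p, cdom (atlas i) p -> D p = div w (scale_field r (grad h)) i p.
Implicit Types (p : M) (f g : M -> R).

Let gi := green_integrand r h D.

Lemma green_integrandD f g : C1_fun f -> C1_fun g ->
  gi (fun p => f p + g p) = (fun p => gi f p + gi g p).
Proof.
move=> fM gM; apply/funext => p; rewrite /gi /green_integrand.
rewrite (metric_gradD _ fM gM); last exact: smooth_fun_C1.
by ring.
Qed.

Lemma green_integrand_integrable f (K : set M) : C1_fun f -> compact K ->
  (forall p, ~ K p -> f p = 0) -> mu.-integrable [set: borel M] (EFin \o gi f).
Proof.
move=> fM cK f0; apply: (compact_support_integrable mu_fin _ cK).
  exact: (green_integrand_continuous r_smooth h_smooth DE).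
exact: (green_integrand_support _ _ h_smooth fM cK f0).
Qed.

Definition bump p : M -> R := sval (cid (bump_exists p)).

Lemma bump_C1 p : C1_fun (bump p).
Proof. by rewrite /bump; case: cid => b []. Qed.

(* The bump functions peel f off one chart at a time: f = f b_p + f (1 - b_p). *)
Lemma green_cover (s : seq M) f (K : set M) : C1_fun f -> compact K ->
  (forall p, ~ K p -> f p = 0) ->
  (forall q, f q * \prod_(p <- s) (1 - bump p q) = 0) ->
  \int[mu]_p gi f p = 0.
Proof.
elim: s f => [|p s ih] f fM cK f0 fs.
  have -> : f = cst 0 by apply/funext => q; have := fs q; rewrite big_nil mulr1.
  rewrite (_ : gi _ = cst 0); first by rewrite Rintegral_cst// mul0r.
  apply/funext => p; rewrite /gi /green_integrand mul0r add0r.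
  have near0 : \forall q \near p, cst (0 : R) q = 0 by exact: nearW.
  by rewrite (metric_grad_near_cst (@C1_fun_cst _ _ M 0) (smooth_fun_C1 h_smooth) near0) mul0r.
pose f1 q := f q * bump p q; pose f2 q := f q * (1 - bump p q).
have c1M : C1_fun (fun q => 1 - bump p q).
  exact: C1_funD (@C1_fun_cst _ _ M 1) (C1_funN (bump_C1 p)).
have f1M : C1_fun f1 := C1_funM fM (bump_C1 p).
have f2M : C1_fun f2 by exact: C1_funM fM c1M.
have f10 q : ~ K q -> f1 q = 0 by move=> /f0 fq; rewrite /f1 fq mul0r.
have f20 q : ~ K q -> f2 q = 0 by move=> /f0 fq; rewrite /f2 fq mul0r.
have -> : f = (fun q => f1 q + f2 q) by apply/funext => q; rewrite /f1 /f2; ring.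
rewrite green_integrandD// RintegralD//; last 2 first.
- exact: green_integrand_integrable f1M cK f10.
- exact: green_integrand_integrable f2M cK f20.
(* The factor of [p] has moved from the product into [f2], so the induction hypothesis applies to
   the shorter list. *)
have f2s q : f2 q * \prod_(p' <- s) (1 - bump p' q) = 0.
  by rewrite -[RHS](fs q) big_cons mulrA.
rewrite (ih f2 f2M cK f20 f2s) addr0.
have [_ [[i [C [cC CV bC]]] _]] := svalP (cid (bump_exists p)).
apply: (green_local Hmu r_smooth h_smooth DE f1M cC CV) => q Cq.
by rewrite /f1 /bump bC// mulr0.
Qed.

(** The open sets on which the bumps equal 1 cover [K]. For a finite subcover the product of the
    factors $1-b_p$ vanishes on [K], and [f] vanishes elsewhere, as [green_cover] asks. *)
Lemma green f (K : set M) : C1_fun f -> compact K ->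
  (forall p, ~ K p -> f p = 0) -> \int[mu]_p gi f p = 0.
Proof.
move=> fM cK f0.
have bO p : exists O : set M, [/\ open O, O p & forall q, O q -> bump p q = 1].
  by have [_ [_]] := svalP (cid (bump_exists p)).
pose O p := sval (cid (bO p)).
have OP p : [/\ open (O p), O p p & forall q, O p q -> bump p q = 1].
  by rewrite /O; case: cid.
have := cK; rewrite compact_cover => /(_ _ setT O)[p _|p Kp|S _ KS].
- by have [] := OP p.
- by exists p => //; have [] := OP p.
apply: (@green_cover (enum_fset S) f K fM cK f0) => q.
have [Kq|/f0 ->] := pselect (K q); last by rewrite mul0r.
have [p /= pS Opq] := KS _ Kq; have [_ _ /(_ _ Opq) bpq] := OP p.
suff -> : \prod_(p <- S) (1 - bump p q) = 0 by rewrite mulr0.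
by apply/eqP; rewrite prodf_seq_eq0; apply/hasP; exists p => //=; rewrite bpq subrr.
Qed.

(** Green's formula for $\chi_kg$ and the Leibniz rule identify the integral of $\chi_k$ times the
    integrand of $g$ with minus a flux term. The latter tends to 0 by assumption, while dominated
    convergence, with the integrand of $g$ as bound, removes $\chi_k$ from the former. *)
Lemma green_limit g (chi : nat -> M -> R) : C1_fun g ->
  (forall k, C1_fun (chi k)) ->
  (forall k, exists2 K : set M, compact K & forall p, ~ K p -> chi k p = 0) ->
  (forall k p, 0 <= chi k p <= 1) ->
  (forall p, chi k p @[k --> \oo] --> (1 : R)) ->
  mu.-integrable [set: borel M] (EFin \o gi g) ->
  (\int[mu]_p (metric (grad (chi k)) (grad h) p * g p * r p)) @[k --> \oo] --> (0 : R) ->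
  \int[mu]_p gi g p = 0.
Proof.
move=> gM chiM chiK chi01 chi1 ig flux0.
have hC := smooth_fun_C1 h_smooth. have rC := smooth_fun_C1 r_smooth.
have E k : \int[mu]_p (chi k p * gi g p) =
    - \int[mu]_p (metric (grad (chi k)) (grad h) p * g p * r p).
  have [K cK K0] := chiK k.
  have fM := C1_funM (chiM k) gM.
  have f0 p : ~ K p -> chi k p * g p = 0 by move=> /K0 ->; rewrite mul0r.
  have cmet : continuous (fun p => metric (grad (chi k)) (grad h) p * g p * r p).
    move=> p; suff : {for p, continuous (metric (grad (chi k)) (grad h) * g * r)} by [].
    apply: continuousM; last exact: (C1_fun_continuous rC).
    apply: continuousM; last exact: (C1_fun_continuous gM).
    exact: (metric_grad_continuous (chiM k) h_smooth).
  have oK : open (~` K).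
    by apply: closed_openC; apply: compact_closed => //; exact: carrier_hausdorff.
  have met0 p : ~ K p -> metric (grad (chi k)) (grad h) p * g p * r p = 0.
    move=> Kp; have near0 : \forall q \near p, chi k q = 0.
      by apply: filterS (open_nbhs_nbhs (conj oK Kp)) => q; exact: K0.
    by rewrite (metric_grad_near_cst (chiM k) hC near0) !mul0r.
  have imet := compact_support_integrable mu_fin cmet cK met0.
  have iall := green_integrand_integrable fM cK f0.
  have -> : (fun p => chi k p * gi g p) = (fun p => gi (fun q => chi k q * g q) p -
      metric (grad (chi k)) (grad h) p * g p * r p).
    apply/funext => p; rewrite /gi /green_integrand (metric_gradM _ (chiM k) gM hC).
    by ring.
  by rewrite RintegralB// (green fM cK f0) sub0r.
have cvg1 : (\int[mu]_p (chi k p * gi g p)) @[k --> \oo] --> \int[mu]_p gi g p.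
  have mchi k : measurable_fun [set: borel M] (chi k).
    exact: continuous_borel_fun (C1_fun_continuous (chiM k)).
  have mg : measurable_fun [set: borel M] (gi g).
    by apply/measurable_EFinP; exact: measurable_int ig.
  have iabs : mu.-integrable [set: borel M] (fun p => `|(gi g p)%:E|%E) by exact: integrable_abse.
  have H : (\int[mu]_p (chi k p * gi g p)%:E)%E @[k --> \oo] --> (\int[mu]_p (gi g p)%:E)%E.
    apply: (@dominated_cvg _ _ _ mu _ _ (fun k p => (chi k p * gi g p)%:E) _ (fun p => `|(gi g p)%:E|%E)) => //.
    - by move=> k; apply/measurable_EFinP; exact: measurable_funM.
    - move=> p _; apply: cvg_EFin; first exact: nearW.
      rewrite -[X in _ --> X]mul1r; apply: cvgM; [exact: chi1|exact: cvg_cst].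
    - move=> k p _; rewrite /= lee_fin normrM; have /andP[c0 c1] := chi01 k p.
      by rewrite -[leRHS]mul1r ler_wpM2r// ger0_norm.
  by apply: fine_cvg; rewrite fineK//; exact: integrable_fin_num.
have cvg0 : (\int[mu]_p (chi k p * gi g p)) @[k --> \oo] --> (0 : R).
  have -> : (fun k => \int[mu]_p (chi k p * gi g p)) =
      (fun k => - \int[mu]_p (metric (grad (chi k)) (grad h) p * g p * r p)).
    by apply/funext => k; rewrite E.
  by have fluxN := cvgN flux0; rewrite oppr0 in fluxN; exact: fluxN.
by rewrite -(cvg_lim _ cvg1)// (cvg_lim _ cvg0).
Qed.

End GreenGlobal.

(** * Time-dependent functions: joint continuity and time derivatives *)

Section TimeFunctions.
Context {R : realType} {n : nat} {M : riemannian_manifold R n}.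
Variables (I : set R).
Hypothesis oI : open I.
Implicit Types (t : R) (p : M) (i : chart_index M) (f : R -> M -> R).

Definition chart_time f i (z : 'rV[R]_(1 + n)) : R :=
  f (lsubmx z 0 0) (cinv (atlas i) (rsubmx z)).

Definition time_domain i : set 'rV[R]_(1 + n) :=
  [set z | I (lsubmx z 0 0) /\ cimg (atlas i) (rsubmx z)].

Lemma chart_timeE f i t x : chart_time f i (at_time t x) = f t (cinv (atlas i) x).
Proof. by rewrite /chart_time /at_time row_mxKl row_mxKr mxE eqxx mulr1n. Qed.

Lemma at_time_domain i t x : I t -> cimg (atlas i) x -> time_domain i (at_time t x).
Proof. by move=> It ix; split; rewrite /at_time ?row_mxKl ?row_mxKr // mxE eqxx mulr1n. Qed.

Lemma smooth_time_slice f t : smooth_time_fun I f -> I t -> smooth_fun (f t).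
Proof.
move=> fI It i; rewrite (_ : _ \o _ = (fun x => chart_time f i (at_time t x))).
  exact: (smooth_on_slice It (fI i)).
by apply/funext => x; rewrite chart_timeE.
Qed.

Lemma is_derive_time f t i x : smooth_time_fun I f -> I t -> cimg (atlas i) x ->
  is_derive t (1 : R) (f ^~ (cinv (atlas i) x))
    (partial (lshift n 0) (chart_time f i) (at_time t x)).
Proof.
move=> fI It ix; rewrite (_ : f ^~ _ = (fun s => chart_time f i (at_time s x))).
  apply: is_derive_at_time.
  by have [_] := fI i [::] _ (at_time_domain It ix); apply.
by apply/funext => s; rewrite chart_timeE.
Qed.

Lemma derivable_time f t p : smooth_time_fun I f -> I t -> derivable (f ^~ p) t 1.
Proof.
move=> fI It; have ip := chart_atP p.
by have [] := is_derive_time fI It (cimg_cmap ip); rewrite cmapK.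
Qed.

Definition jointly_continuous_at (G : R -> M -> R) t p :=
  {for (t, p), continuous (fun z : R * M => G z.1 z.2)}.

Lemma jointly_continuous_chart (G : R -> M -> R) (Gi : 'rV[R]_(1 + n) -> R) i t p :
  I t -> cdom (atlas i) p ->
  (forall s x, I s -> cimg (atlas i) x -> G s (cinv (atlas i) x) = Gi (at_time s x)) ->
  {for at_time t (cmap (atlas i) p), continuous Gi} -> jointly_continuous_at G t p.
Proof.
move=> It ip GE cG.
have cpair : {for (t, p), continuous (fun z : R * M => (z.1, cmap (atlas i) z.2))}.
  move=> P [[P1 P2] /= [P1t P2x] subP].
  exists (P1, cmap (atlas i) @^-1` P2) => /=.
    by split => //; exact: (cmap_continuous ip).
  by move=> [s q] /= [P1s P2q]; exact: subP.
have cat : {for (t, cmap (atlas i) p), continuous (fun z : R * 'rV[R]_n => at_time z.1 z.2)}.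
  exact: at_time_continuous.
have c1 : {for (t, p), continuous ((fun z : R * 'rV[R]_n => at_time z.1 z.2) \o
    (fun z : R * M => (z.1, cmap (atlas i) z.2)))}.
  exact: (@continuous_comp _ _ _ (fun z : R * M => (z.1, cmap (atlas i) z.2)) _ (t, p)).
have c2 : {for (t, p), continuous (Gi \o ((fun z : R * 'rV[R]_n => at_time z.1 z.2) \o
    (fun z : R * M => (z.1, cmap (atlas i) z.2))))} by exact: continuous_comp.
rewrite /jointly_continuous_at /prop_for /continuous_at /=.
have -> : G t p = Gi (at_time t (cmap (atlas i) p)).
  by rewrite -GE ?cmapK//; exact: cimg_cmap.
apply: cvg_trans c2; apply: (@near_eq_cvg _ _ (nbhs (t, p))).
exists (I, cdom (atlas i)) => /=.
  by split; apply: open_nbhs_nbhs; split => //; exact: open_cdom.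
by move=> [s q] /= [Is iq]; rewrite -GE ?cmapK//; exact: cimg_cmap.
Qed.

Lemma smooth_time_continuous f t p : smooth_time_fun I f -> I t -> jointly_continuous_at f t p.
Proof.
move=> fI It; have ip := chart_atP p.
apply: (jointly_continuous_chart (Gi := chart_time f (chart_at p)) It ip).
  by move=> s x _ _; rewrite chart_timeE.
by have [] := fI (chart_at p) [::] _ (at_time_domain It (cimg_cmap ip)).
Qed.

(** In a chart the time derivative is the partial derivative along the first coordinate, continuous
    by joint smoothness. *)
Lemma derive1_time_continuous f t p : smooth_time_fun I f -> I t ->
  jointly_continuous_at (fun s q => derive1 (f ^~ q) s) t p.
Proof.
move=> fI It; have ip := chart_atP p.
apply: (jointly_continuous_chart (Gi := partial (lshift n 0) (chart_time f (chart_at p))) It ip).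
  by move=> s x Is ix; rewrite derive1E; have [] := is_derive_time fI Is ix.
by have [] := fI (chart_at p) [:: lshift n 0] _ (at_time_domain It (cimg_cmap ip)).
Qed.

Lemma jointly_continuousM (F G : R -> M -> R) t p : jointly_continuous_at F t p ->
  jointly_continuous_at G t p -> jointly_continuous_at (fun s q => F s q * G s q) t p.
Proof. by move=> cF cG; exact: continuousM cF cG. Qed.

Lemma jointly_continuousD (F G : R -> M -> R) t p : jointly_continuous_at F t p ->
  jointly_continuous_at G t p -> jointly_continuous_at (fun s q => F s q + G s q) t p.
Proof. by move=> cF cG; exact: continuousD cF cG. Qed.

Lemma jointly_continuous_slice (F : R -> M -> R) t :
  (forall p, jointly_continuous_at F t p) -> continuous (F t).
Proof.
move=> cF p P FP; have [[A B] /= [At Bp] AB] := cF p P FP.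
apply: filterS Bp => q Bq; apply: (AB (t, q)); split => //=.
exact: nbhs_singleton At.
Qed.

Lemma derive1_timeM (f g : R -> M -> R) t p : smooth_time_fun I f -> smooth_time_fun I g -> I t ->
  derive1 (fun s => f s p * g s p) t =
  f t p * derive1 (g ^~ p) t + g t p * derive1 (f ^~ p) t.
Proof.
move=> fI gI It; rewrite !derive1E -[fun s => _]/((f ^~ p) * (g ^~ p)).
by rewrite deriveM//; exact: derivable_time.
Qed.

(** A tube argument: compactness merges local bounds into one neighbourhood of [t0] and one
    constant. The constant is treated as a second parameter tending to infinity, so that a single
    use of the covering property produces both. *)
Lemma compact_time_bound (G : R -> M -> R) t0 : compact [set: M] ->
  (forall p, jointly_continuous_at G t0 p) ->
  exists C, \forall t \near t0, forall p, `|G t p| <= C.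
Proof.
move=> /compact_near_coveringP cM cG.
have := cM (R * R)%type (filter_prod (nbhs t0) (pinfty_nbhs R))
  (fun z p => `|G z.1 p| <= z.2) _.
case=> [p _|[A B] /= [At Boo] AB].
  pose c1 := `|G t0 p| + 1.
  have : {for (t0, p), continuous (fun z : R * M => `|G z.1 z.2|)}.
    by apply: continuous_comp; [exact: cG|exact: norm_continuous].
  move=> /(_ [set y | y < c1])[]; first by apply: lt_nbhsl; rewrite ltrDl.
  move=> [A O] /= [At Op] AO.
  exists (O, A `*` [set y | c1 <= y]) => /=.
    split => //; exists (A, [set y | c1 <= y]) => //=; split => //.
    by apply: nbhs_pinfty_ge; exact: num_real.
  move=> [q [s c]] /= [Oq [As cc]]; apply: le_trans cc; apply: ltW.
  by apply: (AO (s, q)).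
have [C BC] : exists C, B C by exact: filter_ex Boo.
exists C; apply: filterS At => t tA p.
by apply: (AB (t, C)).
Qed.

End TimeFunctions.

(** * The decay conditions on a compact manifold *)

Section CompactDecay.
Context {R : realType} {n : nat} {M : riemannian_manifold R n}.
Variables (mu : {measure set (borel M) -> \bar R}).
Hypothesis mu_fin : (mu [set: borel M] < +oo)%E.
Variables (I : set R) (rho theta : R -> M -> R).
Hypotheses (oI : open I) (rho_smooth : smooth_time_fun I rho)
  (theta_smooth : smooth_time_fun I theta).

(** Continuous functions on a compact manifold of finite volume are integrable, a constant dominates
    the time derivatives, and the cutoff 1 has zero gradient, so both fluxes vanish identically. *)
Lemma compact_decay_at_infinity : compact [set: M] -> decay_at_infinity mu I rho theta.
Proof.
move=> cM.
have int_cont (f : M -> R) : continuous f -> mu.-integrable [set: borel M] (EFin \o f).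
  by move=> cf; apply: (compact_support_integrable mu_fin cf cM) => p /(_ Logic.I).
have crho t p : I t -> jointly_continuous_at rho t p by exact: smooth_time_continuous.
have ctheta t p : I t -> jointly_continuous_at theta t p by exact: smooth_time_continuous.
have cdrho t p := @derive1_time_continuous _ _ _ _ oI rho t p rho_smooth.
have cdtheta t p := @derive1_time_continuous _ _ _ _ oI theta t p theta_smooth.
split.
- move=> t It; apply: int_cont; apply: (@jointly_continuous_slice _ _ _ (fun s p => theta s p * rho s p)) => p.
  by apply: jointly_continuousM; [exact: ctheta|exact: crho].
- move=> t It; have hs := smooth_time_slice theta_smooth It.
  have cr : continuous (rho t) by apply: jointly_continuous_slice => p; exact: crho.
  apply: int_cont => p.
  suff : {for p, continuous (sqnorm (grad (theta t)) * rho t)} by [].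
  apply: continuousM; last exact: cr.
  exact: (metric_grad_continuous (smooth_fun_C1 hs) hs).
- move=> t0 It0.
  have [C1 HC1] := compact_time_bound cM (fun p => cdrho t0 p It0).
  have [C2 HC2] : exists C, \forall t \near t0, forall p,
      `|theta t p * derive1 (rho ^~ p) t + rho t p * derive1 (theta ^~ p) t| <= C.
    apply: compact_time_bound => // p.
    apply: (jointly_continuousD (F := fun t p => theta t p * derive1 (rho ^~ p) t)
      (G := fun t p => rho t p * derive1 (theta ^~ p) t)).
      by apply: jointly_continuousM; [exact: ctheta|exact: cdrho].
    by apply: jointly_continuousM; [exact: crho|exact: cdtheta].
  exists (cst (Num.max C1 C2)); first by apply: int_cont; exact: cst_continuous.
  near=> t => p.
  have It : I t by near: t; exact: open_nbhs_nbhs.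
  rewrite (derive1_timeM _ theta_smooth rho_smooth It) /= !le_max; split; apply/orP.
    by left; move: p; near: t.
  by right; move: p; near: t.
- move=> t It; exists (fun _ => cst 1); split.
  + by move=> _ i; exact: smooth_on_cst.
  + by move=> _; exists setT => // p /(_ Logic.I).
  + by move=> _ p; rewrite ler01 lexx.
  + by move=> p; exact: cvg_cst.
  + have hC := smooth_fun_C1 (smooth_time_slice theta_smooth It).
    have g0 p : metric (grad (cst 1)) (grad (theta t)) p = 0.
      have near1 : \forall q \near p, cst (1 : R) q = 1 by exact: nearW.
      exact: (metric_grad_near_cst (@C1_fun_cst _ _ M 1) hC near1).
    split.
      rewrite (_ : (fun _ => _) = cst 0); first exact: cvg_cst.
      apply/funext => k; rewrite (_ : (fun p => _) = cst 0) ?Rintegral_cst ?mul0r//.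
      by apply/funext => p; rewrite g0 mul0r.
    rewrite (_ : (fun _ => _) = cst 0); first exact: cvg_cst.
    apply/funext => k; rewrite (_ : (fun p => _) = cst 0) ?Rintegral_cst ?mul0r//.
    by apply/funext => p; rewrite g0 !mul0r.
Unshelve. all: by end_near. Qed.

End CompactDecay.

(** * Differentiation under the integral sign; integrals of positive functions *)

Section UnderIntegral.
Context {R : realType} d {Y : measurableType d} {mu : {measure set Y -> \bar R}}.

Lemma is_derive_under_integral (f : R -> Y -> R) (t0 : R) (G : Y -> R) :
  (\forall t \near t0, mu.-integrable [set: Y] (EFin \o f t)) ->
  (\forall t \near t0, forall y, derivable (f ^~ y) t 1) ->
  mu.-integrable [set: Y] (EFin \o G) ->
  (\forall t \near t0, forall y, `|derive1 (f ^~ y) t| <= G y) ->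
  is_derive t0 (1 : R) (fun t => \int[mu]_y f t y) (\int[mu]_y derive1 (f ^~ y) t0).
Proof.
move=> int_f der_f intG fG.
have [e /= e0 He] : exists2 e : R, 0 < e & forall t, ball t0 e t ->
    [/\ mu.-integrable [set: Y] (EFin \o f t), forall y, derivable (f ^~ y) t 1 &
        forall y, `|derive1 (f ^~ y) t| <= G y].
  have : \forall t \near t0, [/\ mu.-integrable [set: Y] (EFin \o f t),
      forall y, derivable (f ^~ y) t 1 & forall y, `|derive1 (f ^~ y) t| <= G y].
    by near=> t; split; near: t.
  by move/nbhs_ballP => [e e0 He]; exists e.
have in_e t : `]t0 - e, t0 + e[%classic t -> ball t0 e t.
  by rewrite /= in_itv/= -ball_normE/= distrC ltr_distl.
have t0e : `]t0 - e, t0 + e[%classic t0.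
  by rewrite /= in_itv/= ltrDl e0 ltrBlDr ltrDl e0.
have G0 y : 0 <= G y by have [_ _ /(_ y)] := He t0 (ballxx t0 e0); exact: le_trans.
have intf t : `]t0 - e, t0 + e[%classic t -> mu.-integrable [set: Y] (EFin \o f t).
  by move=> /in_e/He[].
have derf t y : `]t0 - e, t0 + e[%classic t -> [set: Y] y -> derivable (f ^~ y) t 1.
  by move=> /in_e/He[_ + _] _.
have Gub t y : `]t0 - e, t0 + e[%classic t -> [set: Y] y -> `|partial1of2 f t y| <= G y.
  by move=> /in_e/He[_ _ +] _; exact.
apply: DeriveDef.
  exact: (derivable_under_integral measurableT t0e intf derf G0 intG Gub).
rewrite -derive1E.
exact: (differentiation_under_integral measurableT t0e intf derf G0 intG Gub).
Unshelve. all: by end_near. Qed.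

(** A nonnegative function of integral 0 vanishes almost everywhere; since [f] vanishes nowhere, the
    exceptional null set would be the whole space. *)
Lemma Rintegral_gt0_neq0 (f : Y -> R) : (mu [set: Y] != 0)%E ->
  mu.-integrable [set: Y] (EFin \o f) -> (forall y, 0 < f y) -> \int[mu]_y f y != 0.
Proof.
move=> mu0 intf f0; apply/eqP => If0; move/eqP: mu0; apply.
have mf : measurable_fun [set: Y] (EFin \o f) := measurable_int _ intf.
have : (\int[mu]_y `|(EFin \o f) y|)%E = 0%E.
  transitivity (\int[mu]_y (f y)%:E)%E.
    by apply: eq_integral => y _; rewrite /= ger0_norm// ltW.
  have := integrable_fin_num measurableT intf.
  by move: If0; rewrite /Rintegral; move=> /= + /fineK <- => ->.
move/(ae_eq_integral_abs mu measurableT mf) => [A [mA A0 HA]].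
rewrite -[RHS]A0; congr (mu _); apply/seteqP; split => // y _.
by apply: HA => /= /(_ Logic.I)[] /eqP; rewrite gt_eqF.
Qed.

End UnderIntegral.

(** * Evolution of the mass and of the momentum along a solution *)

Section Evolution.
Context {R : realType} {n : nat} {M : riemannian_manifold R n}.
Variables (w : volume_form M) (mu : {measure set (borel M) -> \bar R}).
Hypotheses (Hmu : volume_measure w mu) (Hmu1 : mu [set: borel M] = 1%E).
Variables (I : set R) (rho theta : R -> M -> R).
Hypotheses (oI : open I) (Hsol : geodesic_solution w mu I rho theta)
  (Hinfty : decay_at_infinity mu I rho theta).

Let m t := mass mu (rho t).
Let xi t := mean_value mu (rho t) (theta t).
Let P t := \int[mu]_p (theta t p * rho t p).
Let H t := hamiltonian mu (rho t) (theta t).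
Let rho_smooth := sol_rho_smooth Hsol.
Let theta_smooth := sol_theta_smooth Hsol.

Let near_I t : I t -> \forall s \near t, I s.
Proof. by move=> It; exact: open_nbhs_nbhs. Qed.

Let mu_fin : (mu [set: borel M] < +oo)%E.
Proof. by rewrite Hmu1 ltry. Qed.

Lemma mass_neq0 t : I t -> m t != 0.
Proof.
move=> It; apply: Rintegral_gt0_neq0 => [||p]; first by rewrite Hmu1 onee_neq0.
  by have := sol_finite_volume Hsol It.
exact: (sol_rho_pos Hsol p It).
Qed.

Lemma momentumE t : I t -> P t = m t * xi t.
Proof. by move=> It; rewrite /xi /mean_value mulrA mulfV ?mul1r//; exact: mass_neq0. Qed.

(** The continuity equation solved for the divergence: a formula free of charts, whose continuity
    and integrability are read off from [rho]. *)
Let D t p := xi t * rho t p - derive1 (rho ^~ p) t.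

Let D_div t : I t -> forall i p, cdom (atlas i) p ->
  D t p = div w (scale_field (rho t) (grad (theta t))) i p.
Proof.
by move=> It i p ip; rewrite /D (sol_rho_eq Hsol It ip) opprD opprK addrC subrK.
Qed.

Let measurable_slice (G : R -> M -> R) t :
  (forall p, jointly_continuous_at G t p) -> measurable_fun [set: borel M] (G t).
Proof. by move=> cG; exact: continuous_borel_fun (jointly_continuous_slice cG). Qed.

Let dominated t : I t -> exists G : M -> R,
  [/\ mu.-integrable [set: borel M] (EFin \o G),
      \forall s \near t, forall p, `|derive1 (rho ^~ p) s| <= G p &
      \forall s \near t, forall p, `|derive1 (fun u => theta u p * rho u p) s| <= G p].
Proof.
move=> It; have [G intG HG] := decay_dominated Hinfty It; exists G; split => //.
  by apply: filterS HG => s sG p; have [] := sG p.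
by apply: filterS HG => s sG p; have [] := sG p.
Qed.

Let integrable_drho t : I t ->
  mu.-integrable [set: borel M] (EFin \o (fun p => derive1 (rho ^~ p) t)).
Proof.
move=> It; have [G [intG /nbhs_singleton rG _]] := dominated It.
apply: (le_integrable measurableT _ _ intG).
  apply/measurable_EFinP; apply: (measurable_slice (G := fun s p => derive1 (rho ^~ p) s)) => p.
  exact: (derive1_time_continuous oI rho_smooth It).
by move=> p _; rewrite /= lee_fin; apply: le_trans (rG p) (ler_norm _).
Qed.

Let integrable_dmomentum t : I t ->
  mu.-integrable [set: borel M] (EFin \o (fun p => derive1 (fun s => theta s p * rho s p) t)).
Proof.
move=> It; have [G [intG _ /nbhs_singleton rG]] := dominated It.
apply: (le_integrable measurableT _ _ intG).
  apply/measurable_EFinP.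
  rewrite (_ : (fun p => _) = (fun p => theta t p * derive1 (rho ^~ p) t + rho t p * derive1 (theta ^~ p) t)).
    apply: (measurable_slice (G := fun s p => theta s p * derive1 (rho ^~ p) s + rho s p * derive1 (theta ^~ p) s)) => p.
    apply: (jointly_continuousD (F := fun t p => theta t p * derive1 (rho ^~ p) t)
      (G := fun t p => rho t p * derive1 (theta ^~ p) t)).
      by apply: jointly_continuousM; [exact: (smooth_time_continuous oI theta_smooth It)|exact: (derive1_time_continuous oI rho_smooth It)].
    by apply: jointly_continuousM; [exact: (smooth_time_continuous oI rho_smooth It)|exact: (derive1_time_continuous oI theta_smooth It)].
  by apply/funext => p; rewrite (derive1_timeM _ theta_smooth rho_smooth It).
by move=> p _; rewrite /= lee_fin; apply: le_trans (rG p) (ler_norm _).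
Qed.

(** The disjunction reflects [decay_flux], which controls the flux at infinity for exactly these two
    test functions. *)
Let green_at t (g : M -> R) : I t -> C1_fun g ->
  mu.-integrable [set: borel M] (EFin \o green_integrand (rho t) (theta t) (D t) g) ->
  (g = cst 1 \/ g = theta t) ->
  \int[mu]_p green_integrand (rho t) (theta t) (D t) g p = 0.
Proof.
move=> It gC ig gE.
have [chi [chiM chiK chi01 chi1 [flux1 fluxth]]] := decay_flux Hinfty It.
apply: (green_limit Hmu mu_fin (smooth_time_slice rho_smooth It)
  (smooth_time_slice theta_smooth It) (D_div It) gC (fun k => smooth_fun_C1 (chiM k)) chiK chi01 chi1 ig).
case: gE => ->; last exact: fluxth.
rewrite (_ : (fun k => _) = (fun k => \int[mu]_p (metric (grad (chi k)) (grad (theta t)) p * rho t p))) //.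
by apply/funext => k; congr (\int[mu]_p _); apply/funext => p; rewrite mulr1.
Qed.

(** For the test function 1 the gradient term drops out, so Green's formula says that
    $\xi\rho-\dot\rho$ has integral 0. *)
Lemma integral_drho t : I t -> \int[mu]_p derive1 (rho ^~ p) t = m t * xi t.
Proof.
move=> It; have ir := sol_finite_volume Hsol It; have idr := integrable_drho It.
have ixr : mu.-integrable [set: borel M] (EFin \o (fun p => xi t * rho t p)).
  rewrite (_ : _ \o _ = (fun p => (xi t)%:E * (EFin \o rho t) p)%E); first exact: integrableZl.
  by [].
have E p : green_integrand (rho t) (theta t) (D t) (cst 1) p = xi t * rho t p - derive1 (rho ^~ p) t.
  have near1 : \forall q \near p, cst (1 : R) q = 1 by exact: nearW.
  have hC := smooth_fun_C1 (smooth_time_slice theta_smooth It).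
  rewrite /green_integrand (metric_grad_near_cst (@C1_fun_cst _ _ M 1) hC near1).
  by rewrite mul0r addr0 mul1r.
have iD : mu.-integrable [set: borel M] (EFin \o (fun p => xi t * rho t p - derive1 (rho ^~ p) t)).
  rewrite (_ : _ \o _ = ((EFin \o (fun p => xi t * rho t p)%R) \- (EFin \o (fun p => derive1 (rho ^~ p) t)%R))%E).
    exact: integrableB.
  by [].
have := @green_at t (cst 1) It (@C1_fun_cst _ _ M 1).
rewrite (_ : green_integrand _ _ _ _ = (fun p => xi t * rho t p - derive1 (rho ^~ p) t)); last first.
  by apply/funext => p; exact: E.
move=> /(_ iD (or_introl erefl)).
rewrite RintegralB// RintegralZl// => /eqP; rewrite subr_eq0 => /eqP <-.
by rewrite mulrC.
Qed.

Lemma integral_dmomentum t : I t ->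
  \int[mu]_p derive1 (fun s => theta s p * rho s p) t = H t.
Proof.
move=> It; have ir := sol_finite_volume Hsol It; have idm := integrable_dmomentum It.
have hs := smooth_time_slice theta_smooth It; have hC := smooth_fun_C1 hs.
have iE := decay_energy Hinfty It.
pose N p := sqnorm (grad (theta t)) p * rho t p.
(* The expected density of $H$: its second term integrates to $\frac{\xi^2}{2}m=\frac{1}{2m}P^2$. *)
pose X p := 2^-1 * N p + (xi t ^+ 2 / 2) * rho t p.
have iN : mu.-integrable [set: borel M] (EFin \o (fun p => 2^-1 * N p)).
  rewrite (_ : _ \o _ = (fun p => (2^-1)%:E * (EFin \o N) p)%E); first exact: integrableZl.
  by [].
have ixr : mu.-integrable [set: borel M] (EFin \o (fun p => (xi t ^+ 2 / 2) * rho t p)).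
  rewrite (_ : _ \o _ = (fun p => (xi t ^+ 2 / 2)%:E * (EFin \o rho t) p)%E); first exact: integrableZl.
  by [].
have iX : mu.-integrable [set: borel M] (EFin \o X).
  rewrite (_ : _ \o _ = ((EFin \o (fun p => 2^-1 * N p)%R) \+ (EFin \o (fun p => (xi t ^+ 2 / 2) * rho t p)%R))%E).
    exact: integrableD.
  by [].
(* The equation for $\dot\theta$ is substituted here, while $\dot\rho$ stays and cancels against the
   one inside [D]; Green's formula for [theta] then equates the integral of [X] with that of the
   time derivative. *)
have E : green_integrand (rho t) (theta t) (D t) (theta t) =
    (fun p => X p - derive1 (fun s => theta s p * rho s p) t).
  apply/funext => p; rewrite (derive1_timeM _ theta_smooth rho_smooth It) (sol_theta_eq Hsol p It).
  rewrite /green_integrand /D /X /N /sqnorm -/(xi t).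
  by field.
have iG : mu.-integrable [set: borel M] (EFin \o green_integrand (rho t) (theta t) (D t) (theta t)).
  rewrite E (_ : _ \o _ = ((EFin \o X) \- (EFin \o (fun p => derive1 (fun s => theta s p * rho s p) t)%R))%E).
    exact: integrableB.
  by [].
have := green_at It hC iG (or_intror erefl).
rewrite E RintegralB// => /eqP; rewrite subr_eq0 => /eqP <-.
rewrite /X RintegralD// !RintegralZl//.
rewrite /H /hamiltonian -/(m t) -/(P t) (momentumE It) -/(mass mu (rho t)) -/(m t).
have := mass_neq0 It; move: (m t) => mt mt0.
congr (_ + _); field.
exact: mt0.
Qed.

Lemma is_derive_mass t : I t -> is_derive t (1 : R) m (m t * xi t).
Proof.
move=> It; rewrite -integral_drho//; have [G [intG rG _]] := dominated It.
have := @is_derive_under_integral R _ (borel M) mu rho t G. apply=> //.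
  by apply: filterS (near_I It) => s Is; exact: (sol_finite_volume Hsol Is).
by apply: filterS (near_I It) => s Is p; exact: (derivable_time rho_smooth Is).
Qed.

Lemma is_derive_momentum t : I t -> is_derive t (1 : R) P (H t).
Proof.
move=> It; rewrite -integral_dmomentum//; have [G [intG _ rG]] := dominated It.
have := @is_derive_under_integral R _ (borel M) mu (fun s p => theta s p * rho s p) t G. apply=> //.
  by apply: filterS (near_I It) => s Is; exact: (decay_momentum Hinfty Is).
apply: filterS (near_I It) => s Is p; apply: derivableM.
  exact: (derivable_time theta_smooth Is).
exact: (derivable_time rho_smooth Is).
Qed.

Lemma evolution t : I t ->
  [/\ is_derive t (1 : R) xi ((m t)^-1 * (H t - m t * xi t ^+ 2)),
      is_derive t (1 : R) m (m t * xi t) &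
      is_derive t (1 : R) (derive1 m) (H t)].
Proof.
move=> It; have dm := is_derive_mass It; have dP := is_derive_momentum It.
have m0 := mass_neq0 It.
split => //.
- have dV : is_derive t (1 : R) (fun s => (m s)^-1) (- (m t) ^- 2 *: (m t * xi t)).
    apply: DeriveDef; first by apply: derivableV => //; have [] := dm.
    by have [dm1 dm2] := dm; rewrite deriveV// dm2.
  have dM := is_deriveM dV dP.
  (* By definition [xi] is the product of the inverse mass and [P], so the product rule applies to
     it. *)
  suff : is_derive t (1 : R) ((fun s => (m s)^-1) * P) ((m t)^-1 * (H t - m t * xi t ^+ 2)) by [].
  apply: is_derive_eq; rewrite (momentumE It) -![_ *: _]/(_ * _).
  by field.
(* On the open set [I] the first derivative of the mass is $m\xi=P$, hence its derivative at [t] is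
   that of [P]. *)
- apply: (@near_eq_is_derive _ _ _ P) => //.
  apply: filterS (near_I It) => s Is; rewrite derive1E momentumE//.
  by have [_ ->] := is_derive_mass Is.
Qed.

End Evolution.

Theorem theorem2p7 (R : realType) (n : nat) (M : riemannian_manifold R n)
    (w : volume_form M) (mu : {measure set (borel M) -> \bar R})
    (Hmu : volume_measure w mu) (Hmu1 : mu [set: borel M] = 1%E)
    (I : set R) (HI : open I) (rho theta : R -> M -> R)
    (Hsol : geodesic_solution w mu I rho theta)
    (Hinfty : compact [set: M] \/ decay_at_infinity mu I rho theta) :
  let m := fun t : R => mass mu (rho t) in
  let xi := fun t : R => mean_value mu (rho t) (theta t) in
  let H := fun t : R => hamiltonian mu (rho t) (theta t) in
  forall t : R, I t ->
    [/\ is_derive t (1 : R) xi ((m t)^-1 * (H t - m t * xi t ^+ 2)),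
        is_derive t (1 : R) m (m t * xi t) &
        is_derive t (1 : R) (derive1 m) (H t)].
Proof.
move=> m xi H t It; apply: (evolution Hmu Hmu1 HI Hsol _ It).
case: Hinfty => // cM.
apply: (compact_decay_at_infinity _ HI (sol_rho_smooth Hsol) (sol_theta_smooth Hsol) cM).
by rewrite Hmu1 ltry.
Qed.
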